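(* Let $n\ge 2$ and let $R=k[x_0,\dots,x_{n-1},y]$ with $\deg x_i=1$, $\deg y=2$ (the coordinate ring of $\mathbb{P}(1^n,2)$). For $d\ge1$ let $R^{(d)}$ be the degree $d$ Veronese subring, $S\to R^{(d)}$ a minimal surjection from a graded polynomial ring, and $N:=\dim \operatorname{Proj}(S)$. For all $d\gg 0$, one has $\beta^S_{i,i+q}(R^{(d)})\neq 0$ for all integers $i$ with $F_q(d)\le i\le B_q(d)$, where $F_q(d)$ and $B_q(d)$ are defined as follows. (1) $q=1$, $d$ even: $F_1(d)=1$ and $B_1(d)=N-\sum_{b=0}^{d/2}\binom{d-2b+n-2}{n-2}+n-2$. (2) $q=1$, $d$ odd: $F_1(d)=1$ and $B_1(d)=N-\sum_{b=0}^{(d-1)/2}\binom{d-2b+n-2}{n-2}+n-3$. (3) $2\le q\le n-1$, $d$ even: $$F_q(d)=\sum_{b=0}^{d/2}\binom{d-2b+q-1}{q-1}-\sum_{b=0}^{\lfloor (d-q-2)/2\rfloor}\binom{d-2b-3}{q-1}-q,$$ $$B_q(d)=N-\sum_{b=0}^{d/2}\binom{d-2b+n-q-1}{n-q-1}+\sum_{b=0}^{\lfloor q/2\rfloor}\binom{-2b+n-1}{n-q-1}-q.$$ (4) $2\le q\le n-1$, $d$ odd: $$F_q(d)=\sum_{b=0}^{(d-1)/2}\binom{d-2b+q-2}{q-2}-\sum_{b=0}^{\lfloor (d-q-1)/2\rfloor}\binom{d-2b-3}{q-2}-q+2,$$ $$B_q(d)=N-\sum_{b=0}^{(d-1)/2}\binom{d-2b+n-q-1}{n-q-1}+\sum_{b=0}^{\lfloor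 q/2\rfloor}\binom{-2b+n-1}{n-q-1}-q-1.$$ (5) $q=n$, $d$ even: $$F_n(d)=\sum_{b=0}^{d/2}\binom{d-2b+n-1}{n-1}-\sum_{b=0}^{\lfloor (d-n-2)/2\rfloor}\binom{d-2b-3}{n-1}-n,\qquad B_n(d)=N-n.$$ (6) $q=n$, $d$ odd: $$F_n(d)=\sum_{b=0}^{(d-1)/2}\binom{d-2b+n-2}{n-2}-\sum_{b=0}^{\lfloor (d-n-1)/2\rfloor}\binom{d-2b-3}{n-2}-n+2,\qquad B_n(d)=N-n-(n\bmod 2).$$ (7) $q=n+1$, $d$ odd: $$F_{n+1}(d)=\sum_{b=0}^{(d-1)/2}\binom{d-2b+n-1}{n-1}-\sum_{b=0}^{\lfloor (d-n-2)/2\rfloor}\binom{d-2b-3}{n-1}-n+1,\qquad B_{n+1}(d)=N-n.$$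
   Context: Here $k$ is a field. The degree $d$ Veronese subring is $R^{(d)}=\bigoplus_{e\ge 0}R_{ed}$, with grading rescaled by $d$: an element of $R_{ed}$ has degree $e$ in $R^{(d)}$. A minimal surjection $S\to R^{(d)}$ means: $S=k[z_0,\dots,z_N]$ is a graded polynomial ring whose variables $z_i$ correspond to the elements of a minimal set of (monomial) $k$-algebra generators of $R^{(d)}$, with $\deg z_i$ equal to the degree in $R$ of the corresponding monomial divided by $d$. $R^{(d)}$ is viewed as a graded $S$-module through this map; it is the coordinate ring of the $d$th Veronese embedding $\varphi_d(\mathbb{P}(1^n,2))\subseteq\operatorname{Proj}(S)$. The graded Betti numbers are $\beta^S_{i,j}(M)=\dim_k\operatorname{Tor}^S_i(M,k)_j$. ''For $d\gg0$'' means for all $d$ larger than some bound depending only on $n$. $(n\bmod 2)\in\{0,1\}$ is the remainder of $n$ modulo $2$. *)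

(* Defs.v *)
From HB Require Import structures.
From mathcomp Require Import all_boot all_order all_algebra mpoly.

Set Warnings "-redundant-canonical-projection".
Set Implicit Arguments.
Unset Strict Implicit.
Unset Printing Implicit Defensive.

Import GRing.Theory.
Local Open Scope ring_scope.

Definition wdeg (n : nat) (w : 'I_n -> nat) (m : 'X_{1..n}) : nat :=
  (\sum_(i < n) m i * w i)%N.

Section WeightedHomogeneous.
Variables (k : fieldType) (n : nat) (w : 'I_n -> nat).

(* The degree is an integer: only [0] is homogeneous of negative degree. *)
Definition whomog (e : int) (p : {mpoly k[n]}) : bool :=
  all (fun m => (wdeg w m)%:Z == e) (msupp p).

End WeightedHomogeneous.

Section Betti.
Variables (k : fieldType) (n : nat) (w : 'I_n -> nat).
Local Notation S := {mpoly k[n]}.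
Variables (M : lmodType S) (Mdeg : int -> M -> Prop).

(* Graded free resolutions                                                    *)
(*   ... -> F_2 -> F_1 -> F_0 -> M -> 0                                       *)
(* with F_i = \bigoplus_a S(- shift i a) of finite rank.  Elements of F_i are *)
(* row vectors, so [diff i] : F_(i+1) -> F_i acts by right multiplication and *)
(* its rows are the images of the basis of F_(i+1).                           *)
Record gfree_resolution := GFreeResolution {
  rk : nat -> nat;
  shift : forall i, 'I_(rk i) -> int;
  diff : forall i, 'M[S]_(rk i.+1, rk i);
  aug : 'I_(rk 0) -> M;
  diff_homog : forall i a b,
    whomog w (shift a - shift b) (diff i a b);
  aug_homog : forall a, Mdeg (shift a) (aug a);
  aug_surj : forall x : M, exists v : 'rV[S]_(rk 0),
    x = \sum_a v 0 a *: aug a;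
  exact_aug : forall v : 'rV[S]_(rk 0),
    \sum_a v 0 a *: aug a = 0 <-> exists u, v = u *m diff 0;
  exact_diff : forall i (v : 'rV[S]_(rk i.+1)),
    v *m diff i = 0 <-> exists u, v = u *m diff i.+1
}.

Variable F : gfree_resolution.

(* k is S modulo its variables, hence the differential of F \otimes_S k is    *)
(* the matrix of constant terms.                                              *)
Definition diffk i : 'M[k]_(rk F i.+1, rk F i) :=
  map_mx (mcoeff 0%MM) (diff F i).

(* Row space: the degree j part of F_i \otimes_S k *)
Definition degpart i (j : int) : 'M[k]_(rk F i) :=
  diag_mx (\row_a (shift a == j)%:R).

Definition tor_cycles i (j : int) : 'M[k]_(rk F i) :=
  match i with
  | 0 => degpart 0 j
  | i'.+1 => (degpart i'.+1 j :&: kermx (diffk i'))%MS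
  end.

Definition tor_boundaries i (j : int) : 'M[k]_(rk F i.+1, rk F i) :=
  degpart i.+1 j *m diffk i.

(* beta^S_(i,j)(M) = dim_k Tor^S_i(M, k)_j, where Tor is the homology of      *)
(* F \otimes_S k (independent of the resolution F of M); [Z :\: B] is a       *)
(* complement of Z :&: B in Z, so its rank is the dimension of Z / B.         *)
Definition betti (i j : int) : nat :=
  match i with
  | Posz i' => \rank (tor_cycles i' j :\: tor_boundaries i' j)%MS
  | Negz _ => 0
  end.

End Betti.

(* A viewed as a module over k[z_0, ..., z_(N-1)] through z_i |-> g i *)
Definition pres_module (k : fieldType) (A : comAlgType k) (N : nat)
  (g : 'I_N -> A) : Type := A.

Section Presentation.
Variables (k : fieldType) (A : comAlgType k) (N : nat) (g : 'I_N -> A).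

Definition pres_map : {mpoly k[N]} -> A := mmap (in_alg A) g.

HB.instance Definition _ := GRing.RMorphism.on pres_map.

Definition generates : Prop := forall a : A, exists p, pres_map p = a.

Local Notation M := (pres_module g).

HB.instance Definition _ := GRing.Zmodule.copy M A.

Definition pres_scale (p : {mpoly k[N]}) (a : M) : M := pres_map p * (a : A).

Fact pres_scaleA p q a : pres_scale p (pres_scale q a) = pres_scale (p * q) a.
Proof. by rewrite /pres_scale rmorphM mulrA. Qed.

Fact pres_scale1 : left_id 1 pres_scale.
Proof. by move=> a; rewrite /pres_scale rmorph1 mul1r. Qed.

Fact pres_scaleDr : right_distributive pres_scale +%R.
Proof. by move=> p a b; rewrite /pres_scale mulrDr. Qed.

Fact pres_scaleDl a : {morph pres_scale^~ a : p q / p + q}.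
Proof. by move=> p q; rewrite /pres_scale rmorphD mulrDl. Qed.

HB.instance Definition _ := GRing.Zmodule_isLmodule.Build {mpoly k[N]}
  M pres_scaleA pres_scale1 pres_scaleDr pres_scaleDl.

End Presentation.

Definition minimally_generates (k : fieldType) (A : comAlgType k) (N : nat)
    (g : 'I_N.+1 -> A) : Prop :=
  generates g /\ forall i : 'I_N.+1,
    ~ generates (fun j : 'I_N => g (lift i j)).

Section Veronese.
Variables (k : fieldType) (n d : nat).

(* R = k[x_0, ..., x_(n-1), y]; the last variable is y. *)
Local Notation R := {mpoly k[n.+1]}.

Definition wtR (i : 'I_n.+1) : nat := if i == ord_max then 2 else 1.

Definition veronese_pred : {pred R} :=
  [pred p | all (fun m => (d %| wdeg wtR m)%N) (msupp p)].

Lemma wdegD (m1 m2 : 'X_{1..n.+1}) :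
  wdeg wtR (m1 + m2) = (wdeg wtR m1 + wdeg wtR m2)%N.
Proof.
by rewrite /wdeg -big_split; apply: eq_bigr => i _; rewrite mnmDE mulnDl.
Qed.

Fact veronese_predP p :
  reflect {in msupp p, forall m, d %| wdeg wtR m}%N (p \in veronese_pred).
Proof. exact: allP. Qed.

Fact veronese_subalg : GRing.subalg_closed veronese_pred.
Proof.
split.
- apply/veronese_predP => m; rewrite msupp1 inE => /eqP ->.
  by rewrite /wdeg big1 // => i _; rewrite mnm0E.
- move=> a p q /veronese_predP hp /veronese_predP hq.
  apply/veronese_predP => m /msuppD_le.
  by rewrite mem_cat => /orP[/msuppZ_le/hp|/hq].
- move=> p q /veronese_predP hp /veronese_predP hq.
  apply/veronese_predP => m /msuppM_le/allpairsP[[m1 m2]] [/= h1 h2 ->].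
  by rewrite wdegD; apply: dvdn_add (hp _ h1) (hq _ h2).
Qed.

HB.instance Definition _ :=
  GRing.isSubalgClosed.Build k R veronese_pred veronese_subalg.

(* The ring R^(d) *)
Record veronese := Veronese {
  veronese_val :> R;
  veronese_valP : veronese_val \in veronese_pred
}.

HB.instance Definition _ := [isSub for veronese_val].
HB.instance Definition _ := [Choice of veronese by <:].
HB.instance Definition _ := [SubChoice_isSubAlgebra of veronese by <:].
HB.instance Definition _ := [SubNzRing_isSubComNzRing of veronese by <:].

(* Rescaled grading: the degree e part of R^(d) is R_(ed). *)
Definition veronese_deg (e : int) (r : veronese) : Prop :=
  whomog wtR (e * d%:Z) (veronese_val r).

End Veronese.

(* Main.v *)
Require Import Defs.
From mathcomp Require Import all_boot all_order all_algebra mpoly.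
From mathcomp Require Import zify ring.

(** The Betti number beta_(i,j) of a module M over S = k[z_0, ..., z_N] is also
    the dimension of the Koszul homology H_i(z; M)_j, and for a ring of
    monomials Koszul classes can be written down explicitly, in the manner of
    Ein, Erman and Lazarsfeld.

    Let D_j be d for the variables x_j, and let D_y be d/2 for d even and d for d
    odd, so that the powers x_j^(D_j) and y^(D_y) are among the generators of
    R^(d).  Let f be a monomial of degree q d with all exponents f_j < D_j.  A
    generator kills f if its product with f is a multiple of one of the powers,
    and survives otherwise.  Let P be a set of i generators that kill f, none of
    them a power, containing all generators that divide f.  For v in P choose a
    power t(v) dividing f m_v.  Each z_t(v) e_v - z_v e_t(v) is a Koszul 1-cycle,
    and the product of these cycles over P, multiplied by f and divided by the
    product of the m_t(v), is a cycle with coefficients in R^(d).  Its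
    coefficient at e_P is f up to sign, while f does not occur at e_P in any
    boundary: it could only come from a generator outside P dividing f.  Hence
    beta_(i,i+q) <> 0 ([betti_neq0]).

    To read this off a given free resolution F, [koszul_homology_betti] pushes a
    Koszul cycle through the double complex of F and the Koszul complex: the rows
    are exact because F is, the columns because of the contraction
    [kcontract].

    As there are N - n generators that are not powers, an f without surviving
    divisors yields every i between the number of generators dividing f and
    N - n minus the number of survivors ([betti_range]).  The bounds F_q and B_q
    are these two numbers for two, possibly equal, monomials of the form x_0^(d-1) ... x_(s-1)^(d-1) x_s^b y^c; the counts
    reduce to inclusion-exclusion on the monomials of degree d in a window of
    the variables ([count_caps]).  It remains to see that the two intervals
    overlap ([betti_range2]).  For d even no divisor of the second monomial
    survives the first.  For d odd some do, but they involve at most three of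
    the variables x and not y, and trading powers of x for powers of y injects
    them into the generators that neither divide the second monomial nor survive
    the first ([overlap_odd]). *)

Set Implicit Arguments.
Unset Strict Implicit.
Unset Printing Implicit Defensive.

Import Order.TTheory GRing.Theory Num.Theory.
Local Open Scope ring_scope.

(** * Monomials and homogeneous components *)

Section Monomials.
Variables (k : fieldType) (V : nat).
Implicit Types (p : {mpoly k[V]}) (m : 'X_{1..V}).

Lemma lemU (m : 'X_{1..V}) i : (0 < m i)%N -> (U_(i) <= m)%MM.
Proof. by move=> h; apply/mnm_lepP => j; rewrite mnm1E; case: eqVneq => // <-. Qed.

Lemma mcoeffXM m0 p m :
  ('X_[m0] * p)@_m = if (m0 <= m)%MM then p@_(m - m0)%MM else 0.
Proof.
case: ifP => h; first by rewrite -[in LHS](submK h) addmC mulrC mcoeffMX.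
apply/eqP; rewrite mcoeff_eq0; apply/negP => /msuppM_le/allpairsP[[m1 m2]] /= [].
rewrite msuppX inE => /eqP -> _ e; move/negP: h; apply; rewrite e.
exact: lem_addr.
Qed.

Lemma mcoeffX1M v p m :
  ('X_v * p)@_m = if (0 < m v)%N then p@_(m - U_(v))%MM else 0.
Proof.
rewrite mcoeffXM; congr (if _ then _ else _); apply/idP/idP => [/mnm_lepP/(_ v)|].
  by rewrite mnm1E eqxx.
exact: lemU.
Qed.

Lemma mcoeff_filter (P : pred 'X_{1..V}) p m :
  (\sum_(m <- msupp p | P m) p@_m *: 'X_[m])@_m = if P m then p@_m else 0.
Proof.
rewrite raddf_sum /= big_mkcond /=.
have E m' : (if P m' then (p@_m' *: 'X_[m'])@_m else 0) =
   if m' == m then (if P m then p@_m else 0) else 0.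
  by rewrite mcoeffZ mcoeffX; case: eqVneq => [->|]; rewrite ?mulr1 ?mulr0 ?if_same.
under eq_bigr do rewrite E.
have [h|h] := boolP (m \in msupp p).
  rewrite (bigD1_seq m) ?msupp_uniq //= eqxx big1 ?addr0 // => i /negbTE -> //.
move: (h); rewrite -mcoeff_eq0 => /eqP ->; rewrite if_same big1 // => i _.
by rewrite if_same.
Qed.

Lemma mpolyX_bigsum (I : Type) (r : seq I) (Q : pred I) (G : I -> 'X_{1..V}) :
  \prod_(i <- r | Q i) 'X_[G i] = 'X_[\sum_(i <- r | Q i) G i] :> {mpoly k[V]}.
Proof. by rewrite (big_morph (mpolyX k) (@mpolyXD _ k) (@mpolyX0 _ k)). Qed.

End Monomials.

Section Homogeneous.
Variables (k : fieldType) (n : nat) (w : 'I_n -> nat).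
Implicit Types (p q : {mpoly k[n]}) (e f : int) (m : 'X_{1..n}).

Lemma whomogP e p :
  reflect (forall m, p@_m != 0 -> (wdeg w m)%:Z = e) (whomog w e p).
Proof.
apply: (iffP allP) => h m; first by rewrite -mcoeff_msupp => /h/eqP.
by rewrite mcoeff_msupp => /h/eqP.
Qed.

Lemma wdeg_add m1 m2 : wdeg w (m1 + m2) = (wdeg w m1 + wdeg w m2)%N.
Proof. by rewrite /wdeg -big_split; apply: eq_bigr => i _; rewrite mnmDE mulnDl. Qed.

Lemma wdeg0 : wdeg w 0%MM = 0%N.
Proof. by rewrite /wdeg big1 // => i _; rewrite mnm0E. Qed.

Lemma wdegU i : wdeg w U_(i) = w i.
Proof.
rewrite /wdeg (bigD1 i) //= mnm1E eqxx mul1n big1 ?addn0 // => j ji.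
by rewrite mnm1E eq_sym (negbTE ji).
Qed.

Lemma wdeg_muln m c : wdeg w (m *+ c) = (wdeg w m * c)%N.
Proof. by rewrite /wdeg big_distrl; apply: eq_bigr => i _; rewrite mulmnE mulnAC. Qed.

Lemma wdeg_sum (I : Type) (r : seq I) (P : pred I) (G : I -> 'X_{1..n}) :
  wdeg w (\sum_(i <- r | P i) G i)%MM = (\sum_(i <- r | P i) wdeg w (G i))%N.
Proof. exact: (big_morph _ wdeg_add wdeg0). Qed.

Lemma whomog0 e : whomog w e (0 : {mpoly k[n]}).
Proof. by apply/whomogP => m; rewrite mcoeff0 eqxx. Qed.

Lemma whomogD e p q : whomog w e p -> whomog w e q -> whomog w e (p + q).
Proof.
move=> /whomogP hp /whomogP hq; apply/whomogP => m; rewrite mcoeffD.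
by case: (eqVneq p@_m 0) => [->|/hp]; rewrite ?add0r // => /hq.
Qed.

Lemma whomogZ e a p : whomog w e p -> whomog w e (a *: p).
Proof.
move=> /whomogP hp; apply/whomogP => m; rewrite mcoeffZ mulf_eq0 negb_or.
by move=> /andP[_ /hp].
Qed.

Lemma whomogN e p : whomog w e p -> whomog w e (- p).
Proof. by rewrite -scaleN1r; exact: whomogZ. Qed.

Lemma whomog_sign e (b : nat) p : whomog w e p -> whomog w e ((-1) ^+ b * p).
Proof. by move=> h; rewrite -signr_odd mulr_sign; case: ifP => // _; exact: whomogN. Qed.

Lemma whomog_sum e (I : Type) (r : seq I) (P : pred I) (G : I -> {mpoly k[n]}) :
  (forall i, P i -> whomog w e (G i)) -> whomog w e (\sum_(i <- r | P i) G i).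
Proof. by move=> h; elim/big_ind: _ => //; [exact: whomog0 | exact: whomogD]. Qed.

Lemma whomogM e f p q :
  whomog w e p -> whomog w f q -> whomog w (e + f) (p * q).
Proof.
move=> /allP hp /allP hq; apply/allP => m /msuppM_le/allpairsP[[m1 m2] /=].
by case=> /hp/eqP <- /hq/eqP <- ->; rewrite wdeg_add PoszD.
Qed.

Lemma whomogX m : whomog w (wdeg w m) ('X_[m] : {mpoly k[n]}).
Proof. by rewrite /whomog msuppX /= eqxx. Qed.

Definition hproj e p : {mpoly k[n]} :=
  \sum_(m <- msupp p | (wdeg w m)%:Z == e) p@_m *: 'X_[m].

Lemma mcoeff_hproj e p m :
  (hproj e p)@_m = if (wdeg w m)%:Z == e then p@_m else 0.
Proof. exact: mcoeff_filter. Qed.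

Lemma hproj_homog e p : whomog w e (hproj e p).
Proof. by apply/whomogP => m; rewrite mcoeff_hproj; case: (_ =P e) => [-> //|_]; rewrite eqxx. Qed.

Lemma hproj_id e p : whomog w e p -> hproj e p = p.
Proof.
move=> /whomogP h; apply/mpolyP => m; rewrite mcoeff_hproj.
by case: (eqVneq p@_m 0) => [->|/h ->]; rewrite ?if_same ?eqxx.
Qed.

Lemma hprojD e : {morph hproj e : p q / p + q}.
Proof.
move=> p q; apply/mpolyP => m; rewrite mcoeffD !mcoeff_hproj mcoeffD.
by case: ifP; rewrite ?addr0.
Qed.

Lemma hproj0 e : hproj e 0 = 0.
Proof. by rewrite /hproj msupp0 big_nil. Qed.

Lemma hprojZ e a p : hproj e (a *: p) = a *: hproj e p.
Proof.
by apply/mpolyP => m; rewrite !(mcoeffZ, mcoeff_hproj); case: ifP; rewrite ?mulr0.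
Qed.

Lemma hproj_sum e (I : Type) (r : seq I) (P : pred I) (G : I -> {mpoly k[n]}) :
  hproj e (\sum_(i <- r | P i) G i) = \sum_(i <- r | P i) hproj e (G i).
Proof. exact: (big_morph _ (hprojD e) (hproj0 e)). Qed.

Lemma hprojM e f p q : whomog w f q -> hproj e (p * q) = hproj (e - f) p * q.
Proof.
move=> hq; rewrite -{1}[p](subrK (hproj (e - f) p)) mulrDl hprojD.
rewrite [X in _ + X]hproj_id; last first.
  by rewrite -{1}(subrK f e); apply: whomogM hq; exact: hproj_homog.
set t := p - _; suff -> : hproj e (t * q) = 0 by rewrite add0r.
apply/mpolyP => m; rewrite mcoeff_hproj mcoeff0; case: eqP => // me; apply/eqP.
rewrite mcoeff_eq0; apply/negP => /msuppM_le/allpairsP[[m1 m2] /=] [].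
rewrite mcoeff_msupp /t mcoeffB mcoeff_hproj => m1t m2q mm.
move: hq => /allP/(_ _ m2q)/eqP m2f.
have e1 : (wdeg w m1)%:Z == e - f.
  by rewrite -me mm wdeg_add PoszD -m2f addrK.
by rewrite e1 subrr eqxx in m1t.
Qed.

(** Monomials are not zero divisors, and multiplying by one shifts all degrees by
    the same amount. *)
Lemma whomogX_inv e (t : 'X_{1..n}) p :
  whomog w e ('X_[t] * p) -> whomog w (e - (wdeg w t)%:Z) p.
Proof.
move=> /whomogP h; apply/whomogP => u u0.
have := h (t + u)%MM; rewrite mulrC mcoeffMX => /(_ u0) <-.
by rewrite wdeg_add PoszD addrC addKr.
Qed.

End Homogeneous.


(** * The Koszul complex *)

Section Koszul.
Variables (V : nat) (S : comNzRingType).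

(** The sign of moving e_v past the smaller factors of e_A, which stand in
    increasing order. *)
Definition ksign (v : 'I_V) (A : {set 'I_V}) : S :=
  (-1) ^+ #|[set a in A | (a < v)%N]|.

(** A chain c stands for the sum over A of c(A) e_A, in all homological degrees
    at once; the coefficient of its differential at A collects the terms at the
    sets v |: A. *)
Definition koszul (L : lmodType S) (z : 'I_V -> S) (c : {set 'I_V} -> L)
    (A : {set 'I_V}) : L :=
  \sum_(v | v \notin A) (ksign v A * z v) *: c (v |: A).

Lemma ksignK v A : ksign v A * ksign v A = 1.
Proof. by rewrite /ksign -exprD addnn -mul2n exprM sqrrN !expr1n. Qed.

Lemma ksignU1 v w (A : {set 'I_V}) : w \notin A ->
  ksign v (w |: A) = (-1) ^+ (w < v)%N * ksign v A.
Proof.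
move=> wA; rewrite /ksign -exprD; congr (_ ^+ _).
have -> : [set a in w |: A | (a < v)%N] =
    (if (w < v)%N then w |: [set a in A | (a < v)%N]
     else [set a in A | (a < v)%N]).
  apply/setP => a; case: ifP => wv; rewrite !inE; case: (eqVneq a w) => // ->.
  - by rewrite wv.
  - by rewrite wv (negbTE wA).
by case: ifP => _ //; rewrite cardsU1 inE (negbTE wA).
Qed.

Lemma ksign_swap v w (A : {set 'I_V}) : v != w -> v \notin A -> w \notin A ->
  ksign v A * ksign w (v |: A) = - (ksign w A * ksign v (w |: A)).
Proof.
move=> vw vA wA; rewrite !ksignU1 //.
have : v != w :> nat by [].
by case: ltngtP => //= _ _; rewrite expr0 expr1; ring.
Qed.

(** The terms that remove v, w and w, v cancel in pairs. *)
Lemma koszulK (L : lmodType S) z (c : {set 'I_V} -> L) A :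
  koszul z (koszul z c) A = 0.
Proof.
pose G v w := (ksign v A * ksign w (v |: A) * (z v * z w)) *: c (w |: (v |: A)).
have E : koszul z (koszul z c) A =
    \sum_(v | v \notin A) \sum_(w | (w \notin A) && (w != v)) G v w.
  apply: eq_bigr => v vA; rewrite scaler_sumr; apply: eq_big => [w|w _].
    by rewrite !inE negb_or andbC.
  by rewrite scalerA; congr (_ *: _); ring.
rewrite E.
have E2 : \sum_(v | v \notin A) \sum_(w | (w \notin A) && (w != v)) G v w =
    \sum_(v | v \notin A) \sum_(w | (w \notin A) && (w < v)%N) (G v w + G w v).
  under [RHS]eq_bigr do rewrite big_split /=.
  rewrite big_split /=.
  rewrite [X in _ = _ + X](exchange_big_dep (fun w => w \notin A)) /=; last first.
    by move=> v w _ /andP[].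
  rewrite -big_split /=; apply: eq_bigr => v vA.
  rewrite (bigID (fun w : 'I_V => (w < v)%N)) /=; congr (_ + _); apply: eq_bigl => w.
    by rewrite -andbA; congr (_ && _); rewrite -val_eqE /=; case: ltngtP.
  rewrite vA -andbA -leqNgt; congr (_ && _).
  by rewrite -val_eqE /=; case: ltngtP.
rewrite E2 big1 // => v vA; rewrite big1 // => w /andP[wA wv].
rewrite /G setUCA ksign_swap //; last first.
  by apply: contraTneq wv => ->; rewrite ltnn.
rewrite -scalerDl; set a := (X in X *: _).
have -> : a = 0 by rewrite /a; ring.
by rewrite scale0r.
Qed.

Lemma koszul_linear (L L' : lmodType S) (h : L -> L') z c A :
  {morph h : x y / x + y} -> (forall a x, h (a *: x) = a *: h x) ->
  h (koszul z c A) = koszul z (fun B => h (c B)) A.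
Proof.
move=> hD hZ; have h0 : h 0 = 0 by rewrite -(scale0r 0) hZ scale0r.
by rewrite /koszul (big_morph h hD h0); apply: eq_bigr => v _; rewrite hZ.
Qed.

Lemma eq_koszul (L : lmodType S) z (c c' : {set 'I_V} -> L) (A : {set 'I_V}) :
  (forall B : {set _}, #|B| = #|A|.+1 -> c B = c' B) -> koszul z c A = koszul z c' A.
Proof.
move=> cc'; apply: eq_bigr => v vA; congr (_ *: _).
by apply: cc'; rewrite cardsU1 vA.
Qed.

Lemma koszulD (L : lmodType S) z (c c' : {set 'I_V} -> L) (A : {set 'I_V}) :
  koszul z (fun B => c B + c' B) A = koszul z c A + koszul z c' A.
Proof. by rewrite -big_split; apply: eq_bigr => v _; rewrite scalerDr. Qed.

Lemma koszulZ (L : lmodType S) z a (c : {set 'I_V} -> L) A :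
  koszul z (fun B => a *: c B) A = a *: koszul z c A.
Proof.
by rewrite scaler_sumr; apply: eq_bigr => v _; rewrite !scalerA mulrC.
Qed.

(** Exterior multiplication by a basis vector. *)
Definition kwedge (L : lmodType S) (i : 'I_V) (c : {set 'I_V} -> L)
    (A : {set 'I_V}) : L :=
  if i \in A then ksign i (A :\ i) *: c (A :\ i) else 0.

(** The differential is an antiderivation for exterior multiplication. *)
Lemma koszul_wedge (L : lmodType S) z i (c : {set 'I_V} -> L) A :
  koszul z (kwedge i c) A = z i *: c A - kwedge i (koszul z c) A.
Proof.
rewrite {2}/kwedge; case: ifP => iA; last first.
  rewrite subr0 /koszul (bigD1 i) ?iA //= /kwedge setU11 setU1K ?iA //.
  rewrite scalerA mulrAC ksignK mul1r big1 ?addr0 // => v /andP[vA vi].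
  by rewrite !inE eq_sym (negbTE vi) iA scaler0.
have iA' : i \notin A :\ i by rewrite !inE eqxx.
rewrite {2}/koszul (bigD1 i) //= setD1K // scalerDr scalerA mulrA ksignK mul1r.
rewrite opprD addrA subrr add0r scaler_sumr -sumrN.
apply: eq_big => [v|v vA].
  by rewrite !inE; case: (eqVneq v i) => [->|_]; rewrite ?iA ?andbT.
have vi : v != i by apply: contraNneq vA => ->.
have vA' : v \notin A :\ i by rewrite !inE negb_and vA orbT.
rewrite /kwedge !inE iA orbT !scalerA.
have -> : (v |: A) :\ i = v |: (A :\ i).
  apply/setP => x; rewrite !inE; case: (eqVneq x i) => //= ->.
  by rewrite eq_sym (negbTE vi).
rewrite -scaleNr; congr (_ *: _).
have E1 : ksign v A = (-1) ^+ (i < v)%N * ksign v (A :\ i).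
  by rewrite -ksignU1 // setD1K.
have E2 : ksign i (v |: A :\ i) = (-1) ^+ (v < i)%N * ksign i (A :\ i).
  by rewrite ksignU1.
rewrite E1 E2; have : v != i :> nat by [].
by case: ltngtP => //= _ _; rewrite expr0 expr1; ring.
Qed.

End Koszul.

(** * Acyclicity of the Koszul complex of a polynomial ring *)

Section MinVar.
Variables (k : fieldType) (V : nat).
Local Notation S := {mpoly k[V]}.
Implicit Types (p : S) (m : 'X_{1..V}).

Definition novar (a : nat) m := [forall u : 'I_V, (u < a)%N ==> (m u == 0)%N].

Definition lowpart (a : nat) p : S :=
  \sum_(m <- msupp p | novar a m) p@_m *: 'X_[m].

(** Divides by v the terms of p whose smallest variable is v and drops all
    others.  These operators split multiplication by the variables, see
    [sum_divmin], and so define a contraction of the Koszul complex. *)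
Definition divmin (v : 'I_V) p : S :=
  \sum_(m <- msupp p | novar v m && (0 < m v)%N) p@_m *: 'X_[m - U_(v)].

Lemma mcoeff_lowpart a p m : (lowpart a p)@_m = if novar a m then p@_m else 0.
Proof. exact: mcoeff_filter. Qed.

Lemma subU1_eq v m m' : (0 < m' v)%N -> ((m' - U_(v))%MM == m) = (m' == (m + U_(v))%MM).
Proof.
move=> /lemU le; by apply/eqP/eqP => [<-|->]; rewrite ?submK ?addmK.
Qed.

Lemma mcoeff_divmin v p m :
  (divmin v p)@_m = if novar v m then p@_(m + U_(v))%MM else 0.
Proof.
rewrite /divmin raddf_sum /=.
have E m' : (novar v m' && (0 < m' v)%N) -> (p@_m' *: 'X_[m' - U_(v)])@_m =
   if m' == (m + U_(v))%MM then p@_(m + U_(v))%MM else 0.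
  move=> /andP[_ h]; rewrite mcoeffZ mcoeffX subU1_eq //.
  by case: eqVneq => [->|]; rewrite ?mulr1 ?mulr0.
rewrite (eq_bigr _ E) big_mkcond /=.
have nv : novar v (m + U_(v))%MM && (0 < (m + U_(v))%MM v)%N = novar v m.
  rewrite mnmDE mnm1E eqxx addn1 andbT.
  apply: eq_forallb => u; rewrite mnmDE mnm1E; case: (ltnP u v) => //= uv.
  suff -> : (v == u) = false by rewrite addn0.
  by apply/negbTE; apply: contraTneq uv => ->; rewrite ltnn.
have [h|h] := boolP ((m + U_(v))%MM \in msupp p).
  rewrite (bigD1_seq _ h) ?msupp_uniq //= eqxx nv big1 ?addr0 //.
  by move=> i /negbTE ->; rewrite if_same.
move: (h); rewrite -mcoeff_eq0 => /eqP ->; rewrite if_same big1 // => i _.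
by rewrite !if_same.
Qed.

Lemma divmin_additive v : {morph divmin v : p q / p + q}.
Proof.
move=> p q; apply/mpolyP => m; rewrite mcoeffD !mcoeff_divmin mcoeffD.
by case: ifP; rewrite ?addr0.
Qed.

Lemma divmin0 v : divmin v 0 = 0.
Proof. by rewrite /divmin msupp0 big_nil. Qed.

Lemma divminZ v a p : divmin v (a *: p) = a *: divmin v p.
Proof.
apply/mpolyP => m; rewrite !(mcoeffZ, mcoeff_divmin).
by case: ifP; rewrite ?mulr0.
Qed.

Lemma divmin_sign v (b : nat) p : divmin v ((-1) ^+ b * p) = (-1) ^+ b * divmin v p.
Proof. by rewrite -signr_odd !mulr_sign; case: ifP => // _; rewrite -!scaleN1r divminZ. Qed.

Lemma novarW a (v : 'I_V) m : (v < a)%N -> (0 < m v)%N -> novar a m = false.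
Proof.
move=> va mv; apply/negbTE/negP => /forallP/(_ v); rewrite va /= => /eqP e.
by rewrite e in mv.
Qed.

Lemma divmin_Xlt (a v : 'I_V) p : (v < a)%N -> divmin a ('X_v * p) = 0.
Proof.
move=> va; apply/mpolyP => m; rewrite mcoeff_divmin mcoeffX1M mcoeff0.
have av : a != v by apply: contraTneq va => ->; rewrite ltnn.
rewrite mnmDE mnm1E (negbTE av) addn0; case: ifP => // n; case: ifP => // h.
by rewrite (novarW va h) in n.
Qed.

Lemma divmin_Xgt (a v : 'I_V) p : (a < v)%N -> divmin a ('X_v * p) = 'X_v * divmin a p.
Proof.
move=> av; apply/mpolyP => m; rewrite mcoeff_divmin !mcoeffX1M mcoeff_divmin.
have va : a != v by apply: contraTneq av => ->; rewrite ltnn.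
rewrite mnmDE mnm1E (negbTE va) addn0.
have -> : novar a (m - U_(v)) = novar a m.
  apply: eq_forallb => u; case: (ltnP u a) => //= ua; rewrite mnmBE mnm1E.
  suff -> : (v == u) = false by rewrite subn0.
  by apply/negbTE; apply: contraTneq (ltn_trans ua av) => ->; rewrite ltnn.
case: (ltnP 0 (m v)) => [h|_]; last by rewrite if_same.
case: ifP => // _; congr (_@__); apply/mnmP => i; rewrite !(mnmDE, mnmBE, mnm1E).
by case: (eqVneq v i) => [<-|_]; rewrite ?(negbTE va); lia.
Qed.

Lemma divmin_Xeq a p : divmin a ('X_a * p) = lowpart a p.
Proof.
apply/mpolyP => m; rewrite mcoeff_divmin mcoeffX1M mcoeff_lowpart.
by rewrite mnmDE mnm1E eqxx addn1 /= addmK.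
Qed.

(** Each monomial involving a variable below a has exactly one smallest
    variable. *)
Lemma sum_divmin (a : nat) p :
  \sum_(v < V | (v < a)%N) 'X_v * divmin v p = p - lowpart a p.
Proof.
apply/mpolyP => m; rewrite raddf_sum mcoeffB mcoeff_lowpart /=.
under eq_bigr do rewrite mcoeffX1M mcoeff_divmin.
case: ifPn => [nv|].
  rewrite subrr big1 // => v va; case: ifP => // mv.
  by rewrite (novarW va mv) in nv.
rewrite negb_forall => /existsP[u0]; rewrite negb_imply => /andP[u0a mu0].
rewrite -lt0n in mu0; rewrite subr0.
case: (@arg_minnP _ u0 (fun v => 0 < m v)%N (@nat_of_ord V) mu0) => v mv vmin.
rewrite (bigD1 v) /=; last exact: leq_ltn_trans (vmin _ mu0) u0a.
rewrite mv (submK (lemU mv)) big1 ?addr0 => [|w /andP[wa wv]].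
  case: ifP => // /negP[]; apply/forallP => u; apply/implyP => uv.
  rewrite mnmBE; case: (posnP (m u)) => [->//|mu].
  by have := vmin _ mu; rewrite leqNgt uv.
case: ifP => // mw; have vw : (v < w)%N.
  by rewrite ltn_neqAle vmin // andbT; apply: contraNneq wv => /ord_inj ->.
have -> // : novar w (m - U_(w)) = false.
apply: (novarW vw); rewrite mnmBE mnm1E.
by rewrite (negbTE wv) subn0.
Qed.

End MinVar.

Section KoszulExact.
Variables (k : fieldType) (V r : nat).
Local Notation S := {mpoly k[V]}.
Local Notation X := (fun v : 'I_V => 'X_v : S).
Implicit Types (c : {set 'I_V} -> 'rV[S]_r).

(** On basis elements this sends z^m e_A to (z^m / z_v) e_(v |: A), where v is the
    smallest variable that occurs in z^m or in A, or to 0 if v already belongs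
    to A.  The sum has at most one term. *)
Definition kcontract c (B : {set 'I_V}) : 'rV[S]_r :=
  \row_j \sum_(v in B | [forall u in B, (v <= u)%N]) divmin v (c (B :\ v) 0 j).

Lemma kcontractE c (B : {set 'I_V}) (v : 'I_V) j :
  v \in B -> {in B, forall u : 'I_V, v <= u}%N ->
  kcontract c B 0 j = divmin v (c (B :\ v) 0 j).
Proof.
move=> vB vmin; rewrite mxE (bigD1 v) /=; last first.
  by rewrite vB; apply/forall_inP.
rewrite big1 ?addr0 // => w /andP[/andP[wB /forall_inP/(_ v vB) wv] /negP[]].
by apply/eqP/ord_inj/eqP; rewrite eqn_leq wv vmin.
Qed.

Lemma koszulE c A j : koszul X c A 0 j =
  \sum_(v | v \notin A) ksign S v A * 'X_v * c (v |: A) 0 j.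
Proof. by rewrite summxE; apply: eq_bigr => v _; rewrite mxE. Qed.

(** Apply [divmin] for a = min A to the vanishing of the differential at A minus
    a: the term at a gives the part of c(A) free of variables below a, the terms
    with v > a give minus the corresponding terms of the contraction, and the
    missing part of c(A) comes from the v < a by [sum_divmin]. *)
Lemma koszul_exact c s :
  (forall A : {set 'I_V}, #|A| = s -> koszul X c A = 0) ->
  exists u, forall A : {set 'I_V}, #|A| = s.+1 -> c A = koszul X u A.
Proof.
move=> kc; exists (kcontract c) => A cA.
have [a0 a0A] : exists a, a \in A by apply/set0Pn; rewrite -card_gt0 cA.
case: (@arg_minnP _ a0 (fun v => v \in A) (@nat_of_ord V) a0A) => a aA amin {a0 a0A}.
have cAa : #|A :\ a| = s by move: cA; rewrite (cardsD1 a) aA => -[].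
have aA' : a \notin A :\ a by rewrite !inE eqxx.
have sg0 (v : 'I_V) (B : {set 'I_V}) : {in B, forall u : 'I_V, v <= u}%N -> ksign S v B = 1.
  move=> h; rewrite /ksign; set D := finset _; suff -> : D = set0 by rewrite cards0.
  by apply/setP => x; rewrite !inE; case xB: (x \in B) => //=; rewrite ltnNge h.
have gta (v : 'I_V) : v \notin A -> (v < a)%N = false -> (a < v)%N.
  move=> vA /negbT; rewrite -leqNgt leq_eqVlt => /orP[/eqP/ord_inj e|//].
  by move: vA; rewrite -e aA.
apply/rowP => j; have := kc _ cAa => /rowP/(_ j).
rewrite koszulE mxE (bigD1 a) //= setD1K // sg0 => [|u]; last first.
  by rewrite inE => /andP[_]; apply: amin.
rewrite mul1r => /(congr1 (divmin a)).
rewrite divmin_additive divmin_Xeq (@divmin0 _ _ a).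
rewrite (big_morph _ (divmin_additive a) (@divmin0 _ _ a)) => e.
rewrite koszulE (bigID (fun v : 'I_V => (v < a)%N)) /=.
have -> : \sum_(v | (v \notin A) && (v < a)%N) ksign S v A * 'X_v * kcontract c (v |: A) 0 j =
   \sum_(v < V | (v < a)%N) 'X_v * divmin v (c A 0 j).
  apply: eq_big => [v|v /andP[vA va]].
    by case: ltnP => // va; rewrite ?andbF // andbT; apply: contraTN va => /amin; rewrite ltnNge => ->.
  have vm : {in A, forall u : 'I_V, v <= u}%N.
    by move=> u /amin; apply: leq_trans (ltnW va).
  rewrite sg0 // mul1r (@kcontractE _ _ v) ?setU11 ?setU1K // => u.
  by rewrite in_setU1 => /predU1P[->//|/vm].
rewrite sum_divmin.
move/eqP: e; rewrite addr_eq0 => /eqP ->; rewrite opprK -addrA.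
rewrite -[LHS]addr0; congr (_ + _); apply/esym/eqP; rewrite addrC addr_eq0.
apply/eqP; rewrite -sumrN [RHS](bigID (fun v : 'I_V => (v < a)%N)) /= [X in _ = X + _]big1 ?add0r.
  apply: eq_big => [v|v /andP[vA /negbTE va]].
    rewrite !inE negb_and negbK.
    case: (eqVneq v a) => [->|va]; rewrite ?aA ?andbF //=.
    by rewrite andbT.
  have av := gta _ vA va.
  have vA' : v \notin A :\ a by rewrite inE (negbTE vA) andbF.
  have am : {in v |: A, forall u : 'I_V, a <= u}%N.
    by move=> u; rewrite in_setU1 => /predU1P[->|/amin//]; exact: ltnW.
  rewrite (@kcontractE _ _ a) ?setU1r //.
  have -> : (v |: A) :\ a = v |: (A :\ a).
    apply/setP => x; rewrite !inE; case: (eqVneq x a) => //= ->.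
    by rewrite ?orbF; apply/esym/negbTE; apply: contraTneq av => ->; rewrite ltnn.
  rewrite -{1}(setD1K aA) ksignU1 // av expr1 -!mulrA /ksign divmin_sign.
  by rewrite divmin_Xgt //; ring.
move=> v /andP[/andP[_ va] vlt].
by rewrite -!mulrA /ksign divmin_sign divmin_Xlt // mulr0 oppr0.
Qed.

(** At the end of the complex only the constant terms are not boundaries. *)
Lemma koszul_exact0 (x : 'rV[S]_r) : map_mx (mcoeff 0%MM) x = 0 ->
  exists u, x = koszul X u set0.
Proof.
move=> x0; exists (kcontract (fun=> x)); apply/rowP => j; rewrite koszulE.
have -> : \sum_(v | v \notin set0) ksign S v set0 * 'X_v * kcontract (fun=> x) (v |: set0) 0 j
    = \sum_(v < V | (v < V)%N) 'X_v * divmin v (x 0 j).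
  apply: eq_big => [v|v _]; first by rewrite inE ltn_ord.
  rewrite (@kcontractE _ _ v) ?setU11 //.
    rewrite /ksign; set D := finset _; suff -> : D = set0 by rewrite cards0 mul1r.
    by apply/setP => w; rewrite !inE.
  by move=> u; rewrite in_setU1 inE orbF => /eqP ->.
rewrite sum_divmin; suff -> : lowpart V (x 0 j) = 0 by rewrite subr0.
apply/mpolyP => m; rewrite mcoeff_lowpart mcoeff0; case: ifP => // /forallP h.
have -> : m = 0%MM by apply/mnmP => i; move: (h i); rewrite ltn_ord mnm0E => /eqP.
by move/rowP: x0 => /(_ j); rewrite !mxE.
Qed.

End KoszulExact.

(** * Betti numbers and Koszul homology *)

Section Balancing.
Variables (k : fieldType) (V : nat) (w : 'I_V -> nat).
Local Notation S := {mpoly k[V]}.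
Variables (M : lmodType S) (Mdeg : int -> M -> Prop).
Variable F : gfree_resolution w Mdeg.
Local Notation X := (fun v : 'I_V => 'X_v : S).

Definition wset (A : {set 'I_V}) : nat := (\sum_(v in A) w v)%N.

(** Homogeneity of total degree j, where e_A has the degree of the product of its
    variables. *)
Definition chomog t (c : {set 'I_V} -> 'rV[S]_(rk F t)) (j : int) (A : {set 'I_V}) :=
  forall b, whomog w (j - (wset A)%:Z - shift b) (c A 0 b).

Lemma chomog_koszul t (c : {set 'I_V} -> 'rV[S]_(rk F t)) j (A : {set 'I_V}) :
  (forall B : {set 'I_V}, #|B| = #|A|.+1 -> chomog c j B) -> chomog (koszul X c) j A.
Proof.
move=> hc b; rewrite koszulE; apply: whomog_sum => v vA.
rewrite -mulrA /ksign; apply: whomog_sign.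
have -> : j - (wset A)%:Z - shift b = (w v)%:Z + (j - (wset (v |: A))%:Z - shift b).
  by rewrite /wset big_setU1 //= PoszD; ring.
apply: whomogM; first by rewrite -wdegU; exact: whomogX.
by apply: hc; rewrite cardsU1 vA.
Qed.

Lemma koszul_mulmx t r (B : 'M[S]_(t, r)) (c : {set 'I_V} -> 'rV[S]_t) A :
  koszul X c A *m B = koszul X (fun A => c A *m B) A.
Proof.
apply: (@koszul_linear _ _ _ _ (fun x : 'rV[S]_t => x *m B)).
  by move=> x y; rewrite mulmxDl.
by move=> a x; rewrite scalemxAl.
Qed.

Lemma const_koszul r (c : {set 'I_V} -> 'rV[S]_r) A :
  map_mx (mcoeff 0%MM) (koszul X c A) = 0.
Proof.
apply/rowP => j; rewrite mxE koszulE mxE raddf_sum big1 // => v _ /=.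
by rewrite mulrAC mulrC mcoeffX1M mnm0E.
Qed.

(** Exactness, at F_0 as well as further on, turns kernel conditions into this
    one, so that the induction of [zigzag] is uniform. *)
Definition kboundary t (x : 'rV[S]_(rk F t)) := exists y, x = y *m diff F t.

(** Modulo the variables x is a cycle of degree j of the complex of F tensor k,
    hence a boundary; the difference has no constant term, so it is in the image
    of the Koszul differential. *)
Lemma betti0_lift (i : nat) j (x : 'rV[S]_(rk F i)) :
  betti F i j = 0%N -> (forall b, whomog w (j - shift b) (x 0 b)) ->
  match i return 'rV[S]_(rk F i) -> Prop with
  | 0 => fun=> True
  | i'.+1 => fun x => map_mx (mcoeff 0%MM) (x *m diff F i') = 0
  end x ->
  exists u y, x = koszul X u set0 + y *m diff F i.
Proof.
move=> /eqP b0 hx cx.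
pose x0 := map_mx (mcoeff 0%MM) x.
have x0d : (x0 <= degpart F i j)%MS.
  suff -> : x0 = x0 *m degpart F i j by exact: submxMl.
  apply/rowP => b; rewrite mul_mx_diag !mxE; case: eqVneq => [_|sb]; rewrite ?mulr1 //.
  rewrite mulr0; apply/eqP; case: eqVneq => // h.
  have /whomogP/(_ _ h) := hx b; rewrite wdeg0 => /esym/eqP.
  by rewrite subr_eq0 eq_sym (negbTE sb).
have x0z : (x0 <= tor_cycles F i j)%MS.
  case: i x hx cx b0 @x0 x0d => [//|i] x hx cx b0 x0 x0d.
  rewrite sub_capmx x0d /=; apply/sub_kermxP.
  rewrite -cx /x0 /diffk -map_mxM //.
have /submxP[y ey] : (x0 <= tor_boundaries F i j)%MS.
  apply: submx_trans x0z _; move: b0; rewrite /= mxrank_eq0 => /eqP b0.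
  by rewrite -(addsmx_diff_cap_eq (tor_cycles F i j) (tor_boundaries F i j)) b0 adds0mx capmxSr.
pose y' := map_mx (@mpolyC V k) (y *m degpart F i.+1 j).
have [|u hu] := @koszul_exact0 k V _ (x - y' *m diff F i).
  rewrite raddfB /= map_mxM /= -/x0 ey /tor_boundaries mulmxA -map_mx_comp.
  rewrite map_mx_id ?subrr // => z; exact: mpolyCK.
by exists u, y'; rewrite -hu subrK.
Qed.

(** One diagonal of the double complex of Koszul chains with coefficients in F.
    If the Koszul differential of c is a boundary y d of F, then y may be taken
    homogeneous and satisfies the same hypothesis one step further along the
    diagonal; the acyclicity of the Koszul complex of the next free module then brings the
    decomposition of y back to c.  At the end of the diagonal the hypothesis is
    that of [betti0_lift]. *)
Lemma zigzag (i : nat) j (b0 : betti F i j = 0%N) s t (c : {set 'I_V} -> 'rV[S]_(rk F t)) :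
  (s + t)%N = i ->
  (forall A : {set 'I_V}, #|A| = s -> chomog c j A) ->
  match s with
  | 0 => match t return ({set 'I_V} -> 'rV[S]_(rk F t)) -> Prop with
         | 0 => fun=> True
         | t'.+1 => fun c => map_mx (mcoeff 0%MM) (c set0 *m diff F t') = 0
         end c
  | s'.+1 => forall A : {set 'I_V}, #|A| = s' -> kboundary (koszul X c A)
  end ->
  exists u y, forall A : {set 'I_V}, #|A| = s -> c A = koszul X u A + y A *m diff F t.
Proof.
elim: s t c => [|s IHs] t c st hc cc.
  move: st; rewrite add0n => ti; rewrite -ti in b0.
  have [||u [y e]] := @betti0_lift t j (c set0) b0.
  - by move=> b; have := hc _ (cards0 _) b; rewrite /wset big_set0 subr0.
  - by case: t {b0 ti hc} c cc.
  exists u, (fun=> y) => A /eqP; rewrite cards_eq0 => /eqP -> //.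
have [y hy] : exists y, forall A : {set 'I_V}, #|A| = s -> koszul X c A = y A *m diff F t.
  have Q (A : {set 'I_V}) : exists y, #|A| = s -> koszul X c A = y *m diff F t.
  by have [/cc[y ->]|nA] := eqVneq #|A| s; [exists y | exists 0; move/eqP: nA].
  by have [y hy] := fin_all_exists Q; exists y.
pose c' (A : {set 'I_V}) : 'rV[S]_(rk F t.+1) :=
  \row_b hproj w (j - (wset A)%:Z - shift b) (y A 0 b).
(* The wrong components of y do not contribute, c being homogeneous. *)
have hy' : forall A : {set 'I_V}, #|A| = s -> koszul X c A = c' A *m diff F t.
  move=> A cA; apply/rowP => b.
  have /hproj_id <- : whomog w (j - (wset A)%:Z - shift b) (koszul X c A 0 b).
    by apply: chomog_koszul => // B; rewrite cA; exact: hc.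
  rewrite hy // mxE hproj_sum [RHS]mxE; apply: eq_bigr => a _.
  rewrite (hprojM _ _ (diff_homog (g:=F) a b)) mxE; congr (hproj _ _ _ * _); ring.
have hc' : forall A : {set 'I_V}, #|A| = s -> chomog c' j A.
  by move=> A _ b; rewrite mxE; exact: hproj_homog.
have [|||u' [v' e]] := IHs t.+1 c'.
- by rewrite addnS -addSn.
- exact: hc'.
- case: s {IHs st cc hy hc'} hc hy' => [|s] hc hy'.
    by rewrite -hy' ?cards0 // const_koszul.
  move=> A cA; apply/exact_diff; rewrite koszul_mulmx.
  rewrite -(@koszulK V _ _ X c A); apply: eq_koszul => B cB.
  by rewrite -hy' // cB cA.
have [A cA|u hu] := @koszul_exact k V _ (fun B => c B - u' B *m diff F t) s.
  rewrite (_ : koszul _ _ _ = koszul X c A - koszul X u' A *m diff F t); last first.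
    rewrite koszul_mulmx -[Y in _ = _ + Y]scaleN1r -koszulZ -koszulD.
    by apply: eq_koszul => B _; rewrite scaleN1r.
  rewrite hy' // e // mulmxDl -[v' A *m _ *m _]mulmxA.
  suff -> : v' A *m (diff F t.+1 *m diff F t) = 0 by rewrite addr0 subrr.
  by rewrite mulmxA; apply/exact_diff; exists (v' A).
by exists u, u' => A cA; rewrite -hu // subrK.
Qed.

(** The case of [zigzag] in which all of the homological degree is on the Koszul
    side; [lift] presents the chain [kap] on the generators of F. *)
Theorem koszul_homology_betti (i : nat) j (kap : {set 'I_V} -> M)
    (lift : {set 'I_V} -> 'rV[S]_(rk F 0)) :
  betti F i j = 0%N ->
  (forall A : {set 'I_V}, kap A = \sum_a lift A 0 a *: aug a) ->
  (forall A : {set 'I_V}, #|A| = i -> chomog lift j A) ->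
  (forall A, koszul X kap A = 0) ->
  exists u, forall A : {set 'I_V}, #|A| = i -> kap A = koszul X u A.
Proof.
move=> b0 hl hh hk.
pose h (x : 'rV[S]_(rk F 0)) := \sum_a x 0 a *: aug a.
have hD : {morph h : x y / x + y}.
  by move=> x y; rewrite /h -big_split; apply: eq_bigr => a _; rewrite mxE scalerDl.
have hZ a x : h (a *: x) = a *: h x.
  by rewrite /h scaler_sumr; apply: eq_bigr => b _; rewrite mxE scalerA.
have [||u [y e]] := @zigzag i j b0 i 0 lift (addn0 i).
- exact: hh.
- case: i {b0 hh} => // i A cA; apply/exact_aug; rewrite -/(h _).
  rewrite (koszul_linear _ _ _ hD hZ) -[RHS](hk A); apply: eq_koszul => B _.
  by rewrite hl.
exists (fun A => h (u A)) => A cA; rewrite hl -/(h _) e // hD.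
rewrite (koszul_linear _ _ _ hD hZ) -[RHS]addr0; congr (_ + _).
by apply/exact_aug; exists (y A).
Qed.

End Balancing.

(** * Products of Koszul 1-cycles *)

Section KoszulProduct.
Variables (V : nat) (S : comNzRingType) (z : 'I_V -> S) (tau : 'I_V -> 'I_V).

(** The exterior product, over i in l, of the 1-cycles
    z_(tau i) e_i - z_i e_(tau i). *)
Fixpoint kprod (l : seq 'I_V) : {set 'I_V} -> S^o :=
  if l is i :: l' then fun A =>
    z (tau i) *: kwedge i (kprod l') A - z i *: kwedge (tau i) (kprod l') A
  else fun A => (A == set0)%:R.

Lemma kprod_cycle l A : koszul z (kprod l) A = 0.
Proof.
elim: l A => [|i l IHl] A /=.
  rewrite /koszul big1 // => v _.
  have -> : (v |: A == set0) = false by apply/negbTE/set0Pn; exists v; rewrite setU11.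
  by rewrite scaler0.
have W j B : kwedge j (koszul z (kprod l)) B = 0.
  by rewrite /kwedge; case: ifP => // _; rewrite IHl scaler0.
rewrite koszulD koszulZ koszul_wedge W subr0.
have -> : koszul z (fun B => - (z i *: kwedge (tau i) (kprod l) B)) A =
    koszul z (fun B => (- z i) *: kwedge (tau i) (kprod l) B) A.
  by apply: eq_koszul => B _; rewrite scaleNr.
by rewrite koszulZ koszul_wedge W subr0 !scalerA mulrC -scalerDl mulNr subrr scale0r.
Qed.

Variable L : pred 'I_V.

(** Expanding the product, e_A can only arise by choosing e_i for the i of l in A
    and e_(tau i) for the others.  A nonzero coefficient forces the factors
    e_(tau i) to be distinct, which is what makes the coefficients divisible in
    [kprod_dvd]. *)
Lemma kprod_coef (l : seq 'I_V) (A : {set 'I_V}) :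
  uniq l -> {in l, forall i, ~~ L i && L (tau i)} ->
  exists a : S,
  kprod l A = a * (\prod_(i <- l | i \in A) z (tau i)
                   * \prod_(i <- l | i \notin A) z i) /\
  (a != 0 -> [/\ {in A, forall v, ~~ L v -> v \in l},
     {in l, forall i, i \notin A -> tau i \in A} &
     {in l &, forall i j, i \notin A -> j \notin A -> tau i = tau j -> i = j}]).
Proof.
elim: l A => [|i l IHl] A /=.
  move=> _ _; exists (A == set0)%:R; rewrite !big_nil !mulr1; split=> //.
  by case: (eqVneq A set0) => [->|_]; rewrite ?mulr0n ?eqxx // => _; split=> // v; rewrite inE.
move=> /andP[il ul] hl.
have hl' : {in l, forall i, ~~ L i && L (tau i)}.
  by move=> j jl; apply: hl; rewrite inE jl orbT.
have /andP[iL tL] : ~~ L i && L (tau i) by apply: hl; rewrite mem_head.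
have nti j : j \in l -> tau i != j.
  by move=> /hl'/andP[+ _]; apply: contraNneq => <-.
have [iA|iA] := boolP (i \in A).
  have [a [ea ha]] := IHl (A :\ i) ul hl'.
  exists (ksign S i (A :\ i) * a); rewrite !big_cons iA /=; split.
    (* i is neither in L nor in l, so it cannot belong to A minus tau i. *)
    have -> : kwedge (tau i) (kprod l) A = 0.
      rewrite /kwedge; case: ifP => // tA.
      have [b [-> hb]] := IHl (A :\ tau i) ul hl'.
      have [->|b0] := eqVneq b 0; first by rewrite mul0r scaler0.
      have [h _ _] := hb b0; have := h i; rewrite !inE iA iL (negbTE il) andbT.
      by move=> /(_ _ isT) H; exfalso; apply: notF; apply: H; apply: contraNneq iL => ->.
    rewrite scaler0 subr0 /kwedge iA ea.
    have E1 : \prod_(j <- l | j \in A :\ i) z (tau j) = \prod_(j <- l | j \in A) z (tau j).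
      rewrite big_seq_cond [RHS]big_seq_cond; apply: eq_bigl => j.
      by rewrite !inE; case jl: (j \in l) => //=; case: eqVneq => // ji; rewrite -ji jl in il.
    have E2 : \prod_(j <- l | j \notin A :\ i) z j = \prod_(j <- l | j \notin A) z j.
      rewrite big_seq_cond [RHS]big_seq_cond; apply: eq_bigl => j.
      by rewrite !inE; case jl: (j \in l) => //=; case: eqVneq => // ji; rewrite -ji jl in il.
    by rewrite E1 E2 /GRing.scale /=; ring.
  move=> a0; have {}a0 : a != 0 by apply: contraNneq a0 => ->; rewrite mulr0.
  have [h1 h2 h3] := ha a0; split.
  - move=> v vA vL; rewrite inE; case: eqVneq => //= vi.
    by apply: h1 => //; rewrite !inE vi.
  - move=> j; rewrite inE => /predU1P[->|jl jA]; first by rewrite iA.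
    have := h2 j jl; rewrite !inE (negbTE jA) andbF => /(_ isT).
    by move=> /andP[].
  - move=> j j'; rewrite !inE => /predU1P[->|jl]; first by rewrite iA.
    move=> /predU1P[->|jl'] jA; first by rewrite iA.
    by move=> jA'; apply: h3 => //; rewrite !inE ?(negbTE jA) ?(negbTE jA') andbF.
have k0 : kwedge i (kprod l) A = 0 by rewrite /kwedge (negbTE iA).
have [tA|tA] := boolP (tau i \in A); last first.
  exists 0; rewrite k0 /kwedge (negbTE tA) !scaler0 subr0 mul0r; split=> //.
  by rewrite eqxx.
have [a [ea ha]] := IHl (A :\ tau i) ul hl'.
exists (- ksign S (tau i) (A :\ tau i) * a); rewrite !big_cons (negbTE iA) /=; split.
  rewrite k0 scaler0 sub0r /kwedge tA ea.
  have E1 : \prod_(j <- l | j \in A :\ tau i) z (tau j) = \prod_(j <- l | j \in A) z (tau j).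
    rewrite big_seq_cond [RHS]big_seq_cond; apply: eq_bigl => j.
    by rewrite !inE; case jl: (j \in l) => //=; rewrite eq_sym nti.
  have E2 : \prod_(j <- l | j \notin A :\ tau i) z j = \prod_(j <- l | j \notin A) z j.
    rewrite big_seq_cond [RHS]big_seq_cond; apply: eq_bigl => j.
    by rewrite !inE; case jl: (j \in l) => //=; rewrite eq_sym nti.
  by rewrite E1 E2 /GRing.scale /=; ring.
move=> a0; have {}a0 : a != 0 by apply: contraNneq a0 => ->; rewrite mulr0.
have [h1 h2 h3] := ha a0.
have nA j : j \in l -> j \notin A -> j \notin A :\ tau i.
  by move=> _ jA; rewrite !inE (negbTE jA) andbF.
have tne j : j \in l -> j \notin A -> tau j != tau i.
  by move=> jl jA; have := h2 j jl (nA _ jl jA); rewrite !inE => /andP[].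
split.
- move=> v vA vL; rewrite inE; case: eqVneq => //= vi.
  by apply: h1 => //; rewrite !inE vA andbT; apply: contraNneq vL => ->.
- move=> j; rewrite inE => /predU1P[->//|jl jA].
  by have := h2 j jl (nA _ jl jA); rewrite !inE => /andP[].
- move=> j j'; rewrite !inE => /predU1P[->|jl] /predU1P[->|jl'] jA jA' //.
  + by move=> e; have := tne _ jl' jA'; rewrite e eqxx.
  + by move=> e; have := tne _ jl jA; rewrite e eqxx.
  + by apply: h3 => //; exact: nA.
Qed.

(** None of the e_(tau i) occurs in the set l, so every factor contributes its
    first term. *)
Lemma kprod_lead (l : seq 'I_V) :
  uniq l -> {in l, forall i, ~~ L i && L (tau i)} ->
  exists b : nat, kprod l [set i in l] = (-1) ^+ b * \prod_(i <- l) z (tau i).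
Proof.
elim: l => [|i l IHl] /=.
  by exists 0%N; rewrite big_nil expr0 mulr1 (_ : finset _ = set0) ?eqxx //; apply/setP => x; rewrite !inE.
move=> /andP[il ul] hl.
have hl' : {in l, forall i, ~~ L i && L (tau i)}.
  by move=> j jl; apply: hl; rewrite inE jl orbT.
have /andP[iL tL] : ~~ L i && L (tau i) by apply: hl; rewrite mem_head.
have [b eb] := IHl ul hl'.
have eA : [set j in i :: l] :\ i = [set j in l].
  by apply/setP => j; rewrite !inE; case: eqVneq => //= ->; rewrite (negbTE il).
exists (#|[set a in [set j in l] | (a < i)%N]| + b)%N.
rewrite [kwedge (tau i) _ _]/kwedge ifF; last first.
  rewrite inE; apply: contraTF tL => /= h.
  move: h; rewrite inE => /predU1P[->//|/hl'/andP[]//].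
rewrite scaler0 subr0 /kwedge ifT ?inE ?eqxx // eA eb big_cons /ksign exprD.
by rewrite /GRing.scale /=; ring.
Qed.

End KoszulProduct.

(** * A nonvanishing criterion for Veronese rings *)

Section VeroneseNonvanishing.
Variables (k : fieldType) (n d V : nat).
Hypothesis d_gt0 : (0 < d)%N.
Variables (g : 'I_V -> veronese k n d) (m : 'I_V -> 'X_{1..n.+1}).
Hypothesis g_mono : forall i, veronese_val (g i) = 'X_[m i].
Local Notation R := {mpoly k[n.+1]}.
Local Notation S := {mpoly k[V]}.
Local Notation w := (fun i => wdeg (@wtR n) (m i) %/ d)%N.
Local Notation M := (pres_module g).
Local Notation X := (fun v : 'I_V => 'X_v : S).
Local Notation z := (fun v : 'I_V => 'X_[m v] : R).

Lemma wdeg_gen i : wdeg (@wtR n) (m i) = (w i * d)%N.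
Proof.
have := veronese_valP (g i); rewrite g_mono => /veronese_predP/(_ (m i)).
by rewrite msuppX mem_seq1 eqxx => /(_ isT) /divnK.
Qed.

(** Exponent of the monomial of R to which z^t is mapped. *)
Definition expand (t : 'X_{1..V}) : 'X_{1..n.+1} := (\sum_i m i *+ t i)%MM.

Lemma wdeg_expand t : wdeg (@wtR n) (expand t) = (wdeg w t * d)%N.
Proof.
rewrite /expand wdeg_sum /wdeg big_distrl /=; apply: eq_bigr => i _.
by rewrite -/(wdeg _ _) wdeg_muln wdeg_gen mulnC mulnA.
Qed.

Lemma val_pres_mapX t : veronese_val (pres_map g 'X_[t]) = 'X_[expand t].
Proof.
rewrite /pres_map mmapX /mmap1 -[veronese_val _]/(\val _) rmorph_prod.
rewrite /expand -mpolyX_bigsum; apply: eq_bigr => i _.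
by rewrite rmorphXn /= g_mono mpolyXn.
Qed.

Lemma val_pres_map_sum (r : seq 'X_{1..V}) (P : pred 'X_{1..V}) (a : 'X_{1..V} -> k) :
  veronese_val (pres_map g (\sum_(t <- r | P t) a t *: 'X_[t])) =
  \sum_(t <- r | P t) a t *: 'X_[expand t].
Proof.
rewrite rmorph_sum -[veronese_val _]/(\val _) raddf_sum /=; apply: eq_bigr => t _.
have -> : pres_map g (a t *: 'X_[t]) = a t *: pres_map g 'X_[t].
  by rewrite /pres_map mmapZ /= mulr_algl.
by rewrite -val_pres_mapX -[veronese_val (_ *: _)]/(\val _) linearZ.
Qed.

Lemma val_scale (p : S) (x : M) :
  veronese_val (p *: x : M) = veronese_val (pres_map g p) * veronese_val x.
Proof. by rewrite -[LHS]/(\val (pres_map g p * (x : veronese k n d))) rmorphM. Qed.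

Lemma val_sum (I : Type) (r : seq I) (P : pred I) (G : I -> M) :
  veronese_val (\sum_(i <- r | P i) G i) = \sum_(i <- r | P i) veronese_val (G i).
Proof.
exact: (big_morph (fun x : M => veronese_val x)).
Qed.

(** The components of a lift in the wrong degrees cancel out, because the
    presentation and the augmentation are homogeneous. *)
Lemma whomog_lift (F : gfree_resolution w (M := M) (@veronese_deg k n d)) e (x : M) :
  veronese_deg e (x : veronese k n d) ->
  exists v : 'rV[S]_(rk F 0), x = \sum_a v 0 a *: aug a /\
     forall a, whomog w (e - shift a) (v 0 a).
Proof.
move=> xe; have [v ev] := aug_surj F x.
exists (\row_a hproj w (e - shift a) (v 0 a)); split; last first.
  by move=> a; rewrite mxE; exact: hproj_homog.
apply: val_inj => /=; rewrite val_sum -(hproj_id xe) ev val_sum hproj_sum.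
apply: eq_bigr => a _; rewrite mxE !val_scale (hprojM _ _ (aug_homog a)).
congr (_ * _).
have -> : e * d%:Z - shift a * d%:Z = (e - shift a) * d%:Z by rewrite mulrBl.
rewrite {1}[v 0 a]mpolyE !val_pres_map_sum hproj_sum [RHS]big_mkcond.
apply: eq_bigr => t _; rewrite hprojZ; case: ifP => [/eqP te|/negP te].
  by rewrite hproj_id //; have := whomogX k (@wtR n) (expand t); rewrite wdeg_expand PoszM te.
suff -> : hproj (@wtR n) ((e - shift a) * d%:Z) ('X_[expand t] : R) = 0 by rewrite scaler0.
apply/mpolyP => u; rewrite mcoeff_hproj mcoeffX mcoeff0; case: (_ =P u) => [<-|]; rewrite ?if_same //.
rewrite wdeg_expand PoszM; case: eqP => // /(mulIf _) h; case: te; apply/eqP/h.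
by rewrite eqz_nat -lt0n.
Qed.

Variables (P : {set 'I_V}) (L : pred 'I_V) (tau : 'I_V -> 'I_V) (f : 'X_{1..n.+1}) (q : nat).
Hypothesis f_deg : wdeg (@wtR n) f = (q * d)%N.
Hypothesis tauP : {in P, forall v, [/\ ~~ L v, L (tau v) & (m (tau v) <= f + m v)%MM]}.
Hypothesis L_coprime : forall u v x, L u -> L v -> m u x != 0%N -> m v x != 0%N -> u = v.
Hypothesis divP : forall v, (m v <= f)%MM -> v \in P.

Let l := enum P.
Let lP : {in l, forall i, ~~ L i && L (tau i)}.
Proof. by move=> i; rewrite mem_enum => /tauP[-> ->]. Qed.
Let lu : uniq l. Proof. exact: enum_uniq. Qed.
Let E : R := \prod_(i <- l) z (tau i).
Let Em : 'X_{1..n.+1} := (\sum_(i <- l) m (tau i))%MM.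

(** In the coefficient at A the factors m (tau i) are already present for i in A.
    The others are pairwise coprime powers, and each divides f m_i. *)
Lemma kprod_dvd A : exists p : R, E * p = 'X_[f] * kprod z tau l A.
Proof.
have [a [-> ha]] := kprod_coef z A lu lP.
have [->|a0] := eqVneq a 0; first by exists 0; rewrite mul0r !mulr0.
have [_ _ h3] := ha a0.
(* T divides f U: at a given variable at most one term of T is nonzero. *)
pose T := (\sum_(i <- l | i \notin A) m (tau i))%MM.
pose U := (\sum_(i <- l | i \notin A) m i)%MM.
have TU : (T <= f + U)%MM.
  apply/mnm_lepP => x; rewrite mnmDE !mnm_sumE.
  have [/hasP[i il /andP[iA ix]]|/hasPn no] :=
    boolP (has (fun i => (i \notin A) && (m (tau i) x != 0%N)) l).
    rewrite big_mkcond [Y in (_ <= _ + Y)%N]big_mkcond !(bigD1_seq i) //= iA.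
    rewrite big_seq_cond big1 => [|j]; last first.
      move=> /andP[jl ji]; case: ifP => // jA; apply/eqP; apply: contraNT ji => jx.
      apply/eqP; apply: h3 => //; apply: (@L_coprime _ _ x) => //.
        by have /andP[] := lP jl.
      by have /andP[] := lP il.
    move: il; rewrite mem_enum => /tauP[_ _ /mnm_lepP/(_ x)]; rewrite mnmDE; lia.
  rewrite big_seq_cond big1 // => j /andP[/no]; rewrite negb_and negbK.
  by case/orP => [->//|]; rewrite negbK => /eqP.
exists (a * 'X_[f + U - T]).
rewrite /E (bigID (fun i => i \in A)) /= !mpolyX_bigsum -/T -/U.
rewrite [LHS](_ : _ = a * 'X_[\sum_(i <- l | i \in A) m (tau i)] * ('X_[T] * 'X_[f + U - T])); last by ring.
by rewrite -mpolyXD addmC submK // mpolyXD; ring.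
Qed.

(** Both terms of the i-th factor have the degree of z_i z_(tau i), counting the
    degree of e_v as that of z_v. *)
Lemma whomog_kprod r (A : {set 'I_V}) :
  whomog (@wtR n) ((\sum_(i <- r) (w i + w (tau i)))%N%:Z * d%:Z
                   - (wset w A)%:Z * d%:Z) (kprod z tau r A).
Proof.
elim: r A => [|i r IHr] A /=.
  rewrite big_nil mul0r sub0r; case: eqVneq => [->|_]; last exact: whomog0.
  rewrite /wset big_set0 mul0r oppr0.
  by have := whomogX k (@wtR n) 0%MM; rewrite wdeg0 mpolyX0.
rewrite /kwedge; set G := \sum_(_ <- _) _.
have H u v : (w u + w v = w i + w (tau i))%N ->
  whomog (@wtR n) (G%:Z * d%:Z - (wset w A)%:Z * d%:Z)
  (z u *: (if v \in A then ksign R v (A :\ v) *: kprod z tau r (A :\ v) else 0) : R^o).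
  move=> uv; case: ifP => vA; last by rewrite scaler0; exact: whomog0.
  have -> : G%:Z * d%:Z - (wset w A)%:Z * d%:Z = (wdeg (@wtR n) (m u))%:Z +
     ((\sum_(i <- r) (w i + w (tau i)))%N%:Z * d%:Z - (wset w (A :\ v))%:Z * d%:Z).
    have -> : wset w A = (w v + wset w (A :\ v))%N by rewrite /wset (big_setD1 v).
    by rewrite /G big_cons -uv [Y in _ = Posz Y + _]wdeg_gen !PoszD PoszM; ring.
  apply: whomogM; first exact: whomogX.
  exact: whomog_sign.
by apply: whomogD; [apply: H; rewrite addnC | apply: whomogN; exact: H].
Qed.

(** The quotient of f [kprod] by the product of the powers is a Koszul cycle.  Were
    the Betti number zero, it would be a boundary; compare the coefficients of
    the monomial f at P. *)
Theorem betti_neq0 (F : gfree_resolution w (M := M) (@veronese_deg k n d)) :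
  betti F #|P| ((\sum_(v in P) w v)%N + q)%N%:Z != 0%N.
Proof.
apply/negP => /eqP b0.
have [p hp] := fin_all_exists kprod_dvd.
have EX : E = 'X_[Em] by rewrite /E mpolyX_bigsum.
have E0 : E != 0 by rewrite EX; apply/eqP => /mpolyP/(_ Em)/eqP; rewrite mcoeffX mcoeff0 eqxx oner_eq0.
set j := Posz (_ + q)%N in b0.
have pdeg A : whomog (@wtR n) ((j - (wset w A)%:Z) * d%:Z) (p A).
  have := whomogM (whomogX k (@wtR n) f) (whomog_kprod l A).
  rewrite -hp EX => /whomogX_inv; rewrite /Em wdeg_sum f_deg.
  have -> : (\sum_(i <- l) wdeg (@wtR n) (m (tau i)) = (\sum_(i <- l) w (tau i)) * d)%N.
    by rewrite big_distrl; apply: eq_bigr => i _; exact: wdeg_gen.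
  rewrite big_split /= /j /l [Y in (Y + _)%N]big_enum /= !PoszD !PoszM.
  by congr whomog; ring.
have pcyc A : koszul z (p : {set 'I_V} -> R^o) A = 0.
  apply: (mulfI E0); rewrite mulr0 -[LHS](koszulZ (L := R^o)).
  rewrite (@eq_koszul _ _ _ _ _ (fun B => 'X_[f] *: (kprod z tau l B : R^o))); last first.
    by move=> B _; rewrite -[LHS]/(E * p B) hp.
  by rewrite koszulZ kprod_cycle scaler0.
have pver A : p A \in veronese_pred d.
  apply/veronese_predP => u; rewrite mcoeff_msupp => u0.
  have /whomogP/(_ _ u0) e := pdeg A; apply/dvdnP.
  have : (d%:Z %| (wdeg (@wtR n) u)%:Z)%Z by rewrite e dvdz_mull.
  by rewrite dvdzE /= => /dvdnP.
pose kap (A : {set 'I_V}) : M := Veronese (pver A).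
have [lift hl] : exists lift : {set 'I_V} -> 'rV[S]_(rk F 0), forall A,
   kap A = \sum_a lift A 0 a *: aug a /\ chomog lift j A.
  have Q A := @whomog_lift F _ (kap A) (pdeg A).
  by have [y hy] := fin_all_exists Q; exists y => A; have [h1 h2] := hy A; split.
have vk (c : {set 'I_V} -> M) A : veronese_val (koszul X c A) =
    koszul z (fun B => veronese_val (c B) : R^o) A.
  rewrite /koszul val_sum; apply: eq_bigr => v _; rewrite val_scale.
  congr (_ * _); rewrite /ksign rmorphM rmorphXn rmorphN1.
  rewrite -[veronese_val _]/(\val _) rmorphM rmorphXn rmorphN1 /=; congr (_ * _).
  rewrite val_pres_mapX; congr mpolyX; rewrite /expand (bigD1 v) //= mnm1E eqxx big1 ?addm0 //.
  by move=> i iv; rewrite mnm1E eq_sym (negbTE iv).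
have [|||u hu] := @koszul_homology_betti _ _ _ _ _ F #|P| j kap lift b0.
- by move=> A; have [] := hl A.
- by move=> A _; have [] := hl A.
- by move=> A; apply: val_inj; rewrite /= vk pcyc.
have := hu P erefl => /(congr1 (@veronese_val k n d)); rewrite vk /=.
move=> /(congr1 (mcoeff f)); rewrite /koszul raddf_sum big1 /=; last first.
  move=> v vP; rewrite /GRing.scale /= -mulrA /ksign -signr_odd mulr_sign.
  have h0 (r : R) : ('X_[m v] * r)@_f = 0.
    by rewrite mcoeffXM ifF //; apply: contraNF vP; exact: divP.
  by case: ifP; rewrite ?mcoeffN h0 ?oppr0.
have [b eb] := kprod_lead z lu lP.
have eP : [set i in l] = P by apply/setP => i; rewrite inE mem_enum.
have -> : p P = (-1) ^+ b * 'X_[f].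
  by apply: (mulfI E0); rewrite hp -eP eb -/E; ring.
rewrite -signr_odd mulr_sign; case: ifP => _; rewrite ?mcoeffN mcoeffX eqxx; move/eqP.
  by rewrite oppr_eq0 oner_eq0.
by rewrite oner_eq0.
Qed.

End VeroneseNonvanishing.

(** * Minimal monomial generators of the Veronese ring *)

Section Weights.
Variable n : nat.
Local Notation y := (@ord_max n).
Local Notation wd := (wdeg (@wtR n)).
Implicit Types t a b : 'X_{1..n.+1}.

Lemma wtR_gt0 i : (0 < @wtR n i)%N.
Proof. by rewrite /wtR; case: ifP. Qed.

Lemma wdeg_gt0 t : t != 0%MM -> (0 < wd t)%N.
Proof.
move=> t0; rewrite lt0n; apply: contra t0; rewrite /wdeg sum_nat_eq0 => /forallP h.
apply/eqP/mnmP => i; rewrite mnm0E; apply/eqP; have := h i.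
by rewrite muln_eq0 [wtR i == _]eqn0Ngt wtR_gt0 orbF.
Qed.

Lemma wdegE t : wd t = (\sum_(i < n) t (widen_ord (leqnSn n) i) + t y * 2)%N.
Proof.
rewrite /wdeg big_ord_recr /= {2}/wtR eqxx; congr (_ + _)%N.
apply: eq_bigr => i _; rewrite /wtR ifF ?muln1 //.
by apply/negbTE; rewrite -val_eqE /= neq_ltn ltn_ord.
Qed.

Lemma wdeg_y t : (forall i, i != y -> t i = 0%N) -> wd t = (t y * 2)%N.
Proof.
move=> h; rewrite wdegE big1 // => i _; apply: h.
by rewrite -val_eqE /= neq_ltn ltn_ord.
Qed.

Lemma mnm_y t : (forall i, i != y -> t i = 0%N) -> t = (U_(y) *+ t y)%MM.
Proof.
move=> h; apply/mnmP => i; rewrite mulmnE mnm1E.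
by case: (eqVneq y i) => [<-|yi]; rewrite ?mul1n // h // eq_sym.
Qed.

Lemma wdeg_subU t i : (0 < t i)%N -> (wd (t - U_(i)) + wtR i)%N = wd t.
Proof. by move=> /lemU h; rewrite -{2}(submK h) wdeg_add wdegU. Qed.

(** Remove variables one at a time, first y as long as two more degrees are
    available, then one of the x; this can only overshoot d if d is odd and no x
    is left. *)
Lemma divisor_of_wdeg d t : (0 < d)%N -> (d <= wd t)%N ->
  (exists2 a, (a <= t)%MM & wd a = d) \/
  odd d /\ (forall i, i != y -> t i = 0%N).
Proof.
move=> d0; have [s ts] := ubnP (wd t); elim: s t ts => // s IHs t ts dt.
have [/existsP[i /andP[iy ti]]|] := boolP [exists i, (i != y) && (0 < t i)%N]; last first.
  rewrite negb_exists => /forallP h.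
  have t0 i : i != y -> t i = 0%N.
    by move=> iy; have := h i; rewrite iy /= -eqn0Ngt => /eqP.
  have [od|ed] := boolP (odd d); [by right | left].
  rewrite (wdeg_y t0) in dt; have d2 : (d = d./2 * 2)%N by lia.
  exists (U_(y) *+ d./2)%MM; last by rewrite wdeg_muln wdegU /wtR eqxx; lia.
  apply/mnm_lepP => j; rewrite mulmnE mnm1E; case: eqVneq => [<-|]; lia.
have step j : (0 < t j)%N -> (d <= wd (t - U_(j)))%N ->
  (exists2 a, (a <= t)%MM & wd a = d) \/
  odd d /\ (forall i, i != y -> (t - U_(j))%MM i = 0%N).
  move=> tj dj; have := wdeg_subU tj; have := wtR_gt0 j => w1 w2.
  have [|//|[a a1 a2]|] := IHs (t - U_(j))%MM; [lia | | by right].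
  by left; exists a => //; apply: lepm_trans a1 (lem_subr _ _).
have [e|ne] := eqVneq (wd t) d; first by left; exists t => //; exact: lepm_refl.
have wi : wtR i = 1%N by rewrite /wtR (negbTE iy).
have := wdeg_subU ti; rewrite wi => ei.
have [ty|ty] := posnP (t y).
  have [|h|[od h]] := step i ti; [lia | by left | exfalso].
  move: ei; rewrite wdeg_y // mnmBE ty sub0n; lia.
have := wdeg_subU ty; rewrite {2}/wtR eqxx => ey.
have [d2|d2] := leqP d.+2 (wd t).
  have [|h|[od h]] := step y ty; [lia | by left | exfalso].
  by have := h _ iy; rewrite mnmBE mnm1E eq_sym (negbTE iy) subn0; lia.
left; exists (t - U_(i))%MM; [exact: lem_subr | lia].
Qed.

End Weights.

Section Generators.
Variables (k : fieldType) (n d : nat).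
Hypothesis d_gt0 : (0 < d)%N.
Local Notation y := (@ord_max n).
Local Notation wd := (wdeg (@wtR n)).
Local Notation R := {mpoly k[n.+1]}.

Definition spans V (m : 'I_V -> 'X_{1..n.+1}) :=
  forall t, (d %| wd t)%N -> exists s, t = expand m s.

(** A monomial in the image of the presentation is the image of a monomial,
    because the presentation maps monomials to monomials. *)
Lemma generates_spans V (g : 'I_V -> veronese k n d) (m : 'I_V -> 'X_{1..n.+1}) :
  (forall i, veronese_val (g i) = 'X_[m i]) -> generates g <-> spans m.
Proof.
move=> g_mono; split=> [gen t dt|sp a].
  have tv : ('X_[t] : R) \in veronese_pred d.
    by apply/veronese_predP => u; rewrite msuppX mem_seq1 => /eqP ->.
  have [p /(congr1 (@veronese_val k n d))] := gen (Veronese tv).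
  rewrite {1}[p]mpolyE (val_pres_map_sum g_mono) /= => /(congr1 (mcoeff t)).
  rewrite mcoeffX eqxx raddf_sum /= => e.
  have [/hasP[s _ /eqP <-]|/hasPn no] := boolP (has (fun s => expand m s == t) (msupp p)).
    by exists s.
  move: e; rewrite big_seq big1 => [/eqP|s /no /negbTE h]; first by rewrite eq_sym oner_eq0.
  by rewrite mcoeffZ mcoeffX h mulr0.
suff [p hp] : exists p, veronese_val (pres_map g p) =
    \sum_(t <- msupp (veronese_val a)) (veronese_val a)@_t *: 'X_[t].
  by exists p; apply: val_inj; rewrite /= hp -mpolyE.
have /veronese_predP := veronese_valP a.
elim: (msupp _) => [|t r IHr] hr.
  by exists 0; rewrite big_nil rmorph0.
have [|p hp] := IHr; first by move=> u ur; apply: hr; rewrite inE ur orbT.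
have [|s ts] := sp t; first by apply: hr; rewrite mem_head.
exists ((veronese_val a)@_t *: 'X_[s] + p); rewrite big_cons -hp rmorphD.
rewrite -[LHS]/(\val _) rmorphD /=; congr (_ + _).
have := @val_pres_map_sum k n d V g m g_mono [:: s] predT (fun=> (veronese_val a)@_t).
by rewrite !big_seq1 ts.
Qed.

Variables (N : nat) (g : 'I_N.+1 -> veronese k n d) (m : 'I_N.+1 -> 'X_{1..n.+1}).
Hypothesis g_mono : forall i, veronese_val (g i) = 'X_[m i].
Hypothesis g_min : minimally_generates g.

Lemma gen_span : spans m.
Proof. by case: g_min => /(generates_spans g_mono). Qed.

(** Substituting the relation for the i-th generator, the other generators would
    still span. *)
Lemma gen_irredundant i (s : 'X_{1..N.+1}) : s i = 0%N -> expand m s <> m i.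
Proof.
move=> si es; case: g_min => _ /(_ i); apply.
apply/(generates_spans (fun j => g_mono (lift i j))) => t /gen_span[s0 ->].
exists [multinom (s0 (lift i j) + s0 i * s (lift i j))%N | j < N].
apply/mnmP => x; rewrite !mnm_sumE (bigD1_ord i) //= mulmnE -es mnm_sumE (bigD1_ord i) //=.
rewrite mulmnE si muln0 add0n big_distrl -big_split /=; apply: eq_bigr => j _.
rewrite !mulmnE mnmE; lia.
Qed.

Lemma expand0 V (m' : 'I_V -> 'X_{1..n.+1}) : expand m' 0%MM = 0%MM.
Proof. by apply/mnmP => x; rewrite mnm_sumE mnm0E big1 // => i _; rewrite mulmnE mnm0E muln0. Qed.

Lemma expandD V (m' : 'I_V -> 'X_{1..n.+1}) (s s' : 'X_{1..V}) :
  expand m' (s + s')%MM = (expand m' s + expand m' s')%MM.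
Proof.
apply/mnmP => x; rewrite mnmDE !mnm_sumE -big_split; apply: eq_bigr => i _ /=.
by rewrite !mulmnE mnmDE mulnDr.
Qed.

Lemma expandU V (m' : 'I_V -> 'X_{1..n.+1}) i : expand m' U_(i)%MM = m' i.
Proof.
apply/mnmP => x; rewrite mnm_sumE (bigD1 i) //= mulmnE mnm1E eqxx muln1.
rewrite big1 ?addn0 // => j ji; by rewrite mulmnE mnm1E eq_sym (negbTE ji) muln0.
Qed.

Lemma expand_ge V (m' : 'I_V -> 'X_{1..n.+1}) (s : 'X_{1..V}) i : (0 < s i)%N -> (m' i <= expand m' s)%MM.
Proof. by move=> /lemU h; rewrite -(submK h) expandD expandU lem_addl. Qed.

Lemma gen_neq0 i : m i != 0%MM.
Proof.
by apply/eqP => e; apply: (@gen_irredundant i 0%MM); rewrite ?mnm0E ?expand0.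
Qed.

Lemma gen_inj : injective m.
Proof.
move=> i j e; apply/eqP; apply/negPn/negP => ij.
by apply: (@gen_irredundant i U_(j)%MM); rewrite ?expandU // mnm1E eq_sym (negbTE ij).
Qed.

Definition veronese_atom t :=
  forall a b, (d %| wd a)%N -> (d %| wd b)%N -> t = (a + b)%MM -> a = 0%MM \/ b = 0%MM.

Lemma gen_atom i : veronese_atom (m i).
Proof.
move=> a b da db e.
have [sa ea] := gen_span da; have [sb eb] := gen_span db.
have [pa|pa] := posnP (sa i); have [pb|pb] := posnP (sb i).
- exfalso; apply: (@gen_irredundant i (sa + sb)%MM); first by rewrite mnmDE pa pb.
  by rewrite expandD -ea -eb.
- left; have := expand_ge m pb; rewrite -eb e => /mnm_lepP h.
  by apply/mnmP => x; have := h x; rewrite mnmDE mnm0E; lia.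
- right; have := expand_ge m pa; rewrite -ea e => /mnm_lepP h.
  by apply/mnmP => x; have := h x; rewrite mnmDE mnm0E; lia.
- left; have := expand_ge m pb; rewrite -eb e => /mnm_lepP h.
  by apply/mnmP => x; have := h x; rewrite mnmDE mnm0E; lia.
Qed.

(** In an expression of an irreducible monomial only one generator can occur. *)
Lemma atom_gen t : (d %| wd t)%N -> t != 0%MM -> veronese_atom t -> exists i, m i = t.
Proof.
move=> dt t0 at_; have [s es] := gen_span dt.
have [i si] : exists i, (0 < s i)%N.
  apply/existsP; apply: contraNT t0; rewrite negb_exists => /forallP h.
  rewrite es (_ : s = 0%MM) ?expand0 //; apply/mnmP => i.
  by have := h i; rewrite -eqn0Ngt mnm0E => /eqP.
exists i; have e : t = (m i + expand m (s - U_(i)))%MM.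
  by rewrite es -{1}(submK (lemU si)) addmC expandD expandU.
have [||/eqP|e0] := at_ _ _ _ _ e.
- by rewrite (wdeg_gen g_mono) dvdn_mull.
- by rewrite (wdeg_expand g_mono) dvdn_mull.
- by rewrite (negbTE (gen_neq0 i)).
- by rewrite e e0 addm0.
Qed.

Lemma dvdn_wdeg_ge a : (d %| wd a)%N -> a != 0%MM -> (d <= wd a)%N.
Proof. by move=> da /wdeg_gt0 h; exact: dvdn_leq. Qed.

Lemma gen_deg1 t : wd t = d -> exists i, m i = t.
Proof.
move=> td; apply: atom_gen; first by rewrite td.
  by apply: contraTneq d_gt0 => t0; rewrite -td t0 wdeg0.
move=> a b da db e.
have [->|/(dvdn_wdeg_ge da) ha] := eqVneq a 0%MM; first by left.
have [->|/(dvdn_wdeg_ge db) hb] := eqVneq b 0%MM; first by right.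
by move: td; rewrite e wdeg_add; lia.
Qed.

Lemma gen_ypow : odd d -> exists i, m i = (U_(y) *+ d)%MM.
Proof.
move=> od; have wy c : wd (U_(y) *+ c)%MM = (c * 2)%N.
  by rewrite wdeg_muln wdegU /wtR eqxx mulnC.
apply: atom_gen; first by rewrite wy dvdn_mulr.
  by apply/eqP => /mnmP/(_ y); rewrite mulmnE mnm1E eqxx mnm0E; lia.
move=> a b da db e.
have a0 i : i != y -> a i = 0%N.
  move=> iy; move/mnmP: e => /(_ i); rewrite mulmnE mnm1E eq_sym (negbTE iy) mnmDE; lia.
have b0 i : i != y -> b i = 0%N.
  move=> iy; move/mnmP: e => /(_ i); rewrite mulmnE mnm1E eq_sym (negbTE iy) mnmDE; lia.
have ab : (a y + b y = d)%N.
  by move/mnmP: e => /(_ y); rewrite mulmnE mnm1E eqxx mnmDE; lia.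
have co : coprime d 2 by rewrite coprime_sym prime_coprime // dvdn2 od.
move: da; rewrite (wdeg_y a0) Gauss_dvdl // => da.
have [a1|a1] := posnP (a y); [left | right].
  by rewrite (mnm_y a0) a1 mulm0n.
have := dvdn_leq a1 da => a2.
by rewrite (mnm_y b0) (_ : b y = 0%N) ?mulm0n //; lia.
Qed.

(** In degree 2 d and above every monomial splits off a divisor of degree d, or,
    for d odd, is a power of y, hence a multiple of y^d. *)
Lemma gen_cases i : wd (m i) = d \/ odd d /\ m i = (U_(y) *+ d)%MM.
Proof.
have di : (d %| wd (m i))%N by rewrite (wdeg_gen g_mono) dvdn_mull.
have ge := dvdn_wdeg_ge di (gen_neq0 i).
have [e|ne] := eqVneq (wd (m i)) d; [by left | right].
have split a : (a <= m i)%MM -> (d %| wd a)%N -> a != 0%MM -> a != m i -> False.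
  move=> ai da a0 am; have e : m i = (a + (m i - a))%MM by rewrite addmC submK.
  have db : (d %| wd (m i - a))%N by move: di; rewrite e wdeg_add dvdn_addr // -e.
  have [/eqP|b0] := gen_atom da db e; first by rewrite (negbTE a0).
  by move: am; rewrite e b0 addm0 eqxx.
have [[a ai ad]|[od h]] := divisor_of_wdeg d_gt0 ge.
  exfalso; apply: (split a ai); first by rewrite ad.
    by apply: contraTneq d_gt0 => a0; rewrite -ad a0 wdeg0.
  by apply: contraNneq ne => <-; rewrite ad.
split=> //; have co : coprime d 2 by rewrite coprime_sym prime_coprime // dvdn2 od.
have dy : (d %| m i y)%N by move: di; rewrite (wdeg_y h) Gauss_dvdl.
have y0 : (0 < m i y)%N.
  by rewrite lt0n; apply: contraNneq (gen_neq0 i) => y0; rewrite (mnm_y h) y0 mulm0n.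
have leU : (U_(y) *+ d <= m i)%MM.
  apply/mnm_lepP => x; rewrite mulmnE mnm1E; case: eqVneq => [<-|_] //.
  by rewrite mul1n; apply: dvdn_leq.
apply/esym/eqP/negPn/negP => /(split _ leU); apply.
  by rewrite wdeg_muln dvdn_mull.
by apply/eqP => /mnmP/(_ y); rewrite mulmnE mnm1E eqxx mnm0E; lia.
Qed.

End Generators.

(** * Counting monomials of a given weighted degree *)

Section Counting.
Local Open Scope nat_scope.

(** The number of monomials of degree e in r + 1 variables of weight 1 and one
    of weight 2; b is the exponent of the latter. *)
Definition nmonoms (r e : nat) : nat :=
  \sum_(0 <= b < e./2.+1) 'C(e - 2 * b + r, r).

Lemma nmonoms_front d s : s.+3 <= d ->
  nmonoms s (d - s.+3) = \sum_(0 <= b < (d - s.+3)./2.+1) 'C(d - 2 * b - 3, s).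
Proof. by move=> sn; rewrite /nmonoms; apply: eq_big_nat => b hb; congr 'C(_, _); lia. Qed.

Lemma nmonoms_back n q : q < n ->
  nmonoms (n - q - 1) q = \sum_(0 <= b < q./2.+1) 'C(n - 1 - 2 * b, n - q - 1).
Proof. by move=> qn; apply: eq_big_nat => b hb; congr 'C(_, _); lia. Qed.

Variable n : nat.
Local Notation y := (@ord_max n).
Local Notation wd := (wdeg (@wtR n)).
Implicit Types u : 'X_{1..n.+1}.

Variables (lo r : nat).
Hypothesis lor : lo + r < n.

Definition window (i : 'I_n.+1) := lo <= i <= lo + r.

Lemma window_y i : window i -> i != y.
Proof. by rewrite /window -val_eqE /=; lia. Qed.

Definition wmonom (b : nat) (t : 'X_{1..r.+1}) : 'X_{1..n.+1} :=
  [multinom if i == y then b else if window i then t (inord (i - lo)) else 0 | i < n.+1].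

Definition wmonoms (e : nat) : seq 'X_{1..n.+1} :=
  [seq wmonom b t | b <- iota 0 e./2.+1,
                    t <- [seq s2m (val t) | t <- enum (mpoly.basis r.+1 (e - 2 * b))]].

Lemma wdeg_wmonom b t : wd (wmonom b t) = mdeg t + b * 2.
Proof.
rewrite wdegE mnmE eqxx; congr (_ + _); rewrite mdegE.
pose G i := if lo <= i <= lo + r then t (inord (i - lo)) else 0.
rewrite (eq_bigr (fun i : 'I_n => G i)) => [|i _]; last first.
  by rewrite mnmE ifF // -val_eqE /= ltn_eqF.
rewrite -(big_mkord predT G) (@big_cat_nat _ _ _ lo) //=; try by lia.
rewrite (@big_cat_nat _ _ _ (lo + r).+1 lo) //=; try by lia.
rewrite [X in X + _]big_nat_cond [X in X + _]big1 ?add0n => [|i]; last by rewrite /G; case: ifP => //; lia.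
rewrite [X in _ + X]big_nat_cond [X in _ + X]big1 ?addn0 => [|i]; last by rewrite /G; case: ifP => //; lia.
rewrite -{1}[lo]add0n big_addn (_ : (lo + r).+1 - lo = r.+1); last lia.
rewrite big_mkord; apply: eq_bigr => i _; rewrite /G ifT; last by have := ltn_ord i; lia.
by congr (t _); apply: val_inj; rewrite /= addnK inordK.
Qed.

Lemma mem_wmonoms e u : (u \in wmonoms e) =
  (wd u == e) && [forall i, (i != y) && (u i != 0) ==> window i].
Proof.
apply/allpairsPdep/andP => [[b [t []]]|[/eqP ue /forallP h]].
  rewrite mem_iota add0n => /andP[_ be]; rewrite -basis_cover => /eqP te ->; split.
    by rewrite wdeg_wmonom te; lia.
  by apply/forallP => i; rewrite mnmE; case: (i == y) => //=; case: (window i); rewrite ?implybT.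
pose t : 'X_{1..r.+1} := [multinom u (inord (lo + j)) | j < r.+1].
have ut : u = wmonom (u y) t.
  apply/mnmP => i; rewrite mnmE; case: (eqVneq i y) => [->//|iy].
  case: ifP => [wi|/negbT wi].
    rewrite mnmE; congr (u _); apply: val_inj; move: wi; rewrite /window /= => wi.
    by rewrite !inordK; lia.
  by have := h i; rewrite iy (negbTE wi) implybF negbK => /eqP.
have := wdeg_wmonom (u y) t; rewrite -ut ue => et.
exists (u y), t; split=> //; first by rewrite mem_iota; lia.
by rewrite -basis_cover; apply/eqP; lia.
Qed.

Lemma wmonoms_uniq e : uniq (wmonoms e).
Proof.
apply: allpairs_uniq_dep => [|b _|[b t] [b' t'] _ _ /= /mnmP h].
- exact: iota_uniq.
- exact: uniq_basis.
have bb : b = b' by have := h y; rewrite !mnmE eqxx.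
rewrite -bb; congr Tagged; apply/mnmP => j.
have jr := ltn_ord j.
have := h (inord (lo + j)); rewrite !mnmE.
have v : (inord (lo + j) : 'I_n.+1) = lo + j :> nat by rewrite inordK; lia.
have vy : ((inord (lo + j) : 'I_n.+1) == y) = false by rewrite -val_eqE /= v; lia.
rewrite !vy /window v addKn inord_val.
have -> // : lo <= lo + j <= lo + r by lia.
Qed.

Lemma size_wmonoms e : size (wmonoms e) = nmonoms r e.
Proof.
rewrite size_allpairs_dep sumnE big_map /nmonoms /index_iota subn0.
apply: eq_bigr => b _; rewrite size_basis -bin_sub ?leq_addr //; congr 'C(_, _); lia.
Qed.

(** Among the monomials of degree d in the window, those respecting the caps are
    disjoint from the multiples of the (c+1)-st power of v0, from the r powers
    x_j^d with x_j other than v0, and, for d even, from y^(d/2). *)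
Lemma count_caps d (D : seq 'X_{1..n.+1}) (v0 : 'I_n.+1) (c : nat) :
  window v0 -> c < d -> uniq D ->
  {in D, forall u, [/\ wd u = d, (forall i, i != y -> u i != 0 -> window i),
     u v0 <= c, (forall i, i != y -> u i < d) & ~~ odd d -> u y < d./2]} ->
  size D + nmonoms r (d - c.+1) + r + ~~ odd d <= nmonoms r d.
Proof.
move=> wv cd uD hD.
pose x j : 'I_n.+1 := inord (lo + j).
have xE j : j <= r -> x j = lo + j :> nat by move=> jr; rewrite /x inordK; lia.
have xy j : j <= r -> x j != y by move=> jr; rewrite -val_eqE /= xE //; lia.
pose L2 := [seq (u + U_(v0) *+ c.+1)%MM | u <- wmonoms (d - c.+1)].
pose J := rem (v0 - lo) (iota 0 r.+1).
pose L3 := [seq (U_(x j) *+ d)%MM | j <- J].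
pose L4 := if odd d then [::] else [:: (U_(y) *+ d./2)%MM].
have v0y := window_y wv.
have JP j : j \in J -> j <= r /\ x j != v0.
  rewrite mem_rem_uniq ?iota_uniq // !inE mem_iota => /andP[jv jr].
  by split; [lia | rewrite -val_eqE /= xE; move: wv; rewrite /window; lia].
have U_at (i j : 'I_n.+1) e : (U_(i) *+ e)%MM j = (i == j) * e by rewrite mulmnE mnm1E.
have s2 : size L2 = nmonoms r (d - c.+1) by rewrite size_map size_wmonoms.
have s3 : size L3 = r.
  rewrite size_map size_rem ?size_iota // mem_iota; move: wv; rewrite /window; lia.
have s4 : size L4 = ~~ odd d by rewrite /L4; case: ifP.
rewrite -s2 -{1}s3 -s4 -!size_cat -size_wmonoms.
apply: uniq_leq_size.
  rewrite !cat_uniq uD /=.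
  have u2 : uniq L2 by rewrite map_inj_uniq ?wmonoms_uniq // => a b /addIm.
  have u3 : uniq L3.
    rewrite map_inj_in_uniq ?rem_uniq ?iota_uniq // => i j /JP[ir _] /JP[jr _].
    move=> /mnmP/(_ (x i)); rewrite !U_at eqxx; case: eqVneq => [e _|]; last by lia.
    by move/(congr1 val): e; rewrite /= !xE; lia.
  have u4 : uniq L4 by rewrite /L4; case: ifP.
  rewrite u2 u3 u4 /= !andbT -andbA.
  have in4 u : u \in L4 -> ~~ odd d /\ u = (U_(y) *+ d./2)%MM.
    by rewrite /L4; case: ifP => //; rewrite inE => _ /eqP.
  have in2 u : u \in L2 -> c < u v0.
    by move=> /mapP[b _ ->]; rewrite mnmDE U_at eqxx; lia.
  apply/and3P; split; [|apply/hasPn => u|apply/hasPn => u].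
  - apply/hasPn => u /in2 h; apply/negP => /hD[_ _ h2 _ _]; lia.
  - case/mapP => j /JP[jr xv] ->; rewrite /= mem_cat negb_or; apply/andP; split.
      by apply/negP => /hD[_ _ _ /(_ (x j) (xy _ jr)) + _]; rewrite U_at eqxx; lia.
    by apply/negP => /in2; rewrite U_at (negbTE xv).
  - move=> /in4[ed ->]; rewrite /= !mem_cat !negb_or -andbA; apply/and3P; split.
    + by apply/negP => /hD[_ _ _ _ /(_ ed)]; rewrite U_at eqxx; lia.
    + by apply/negP => /in2; rewrite U_at eq_sym (negbTE v0y).
    + apply/negP => /mapP[j /JP[jr _] /mnmP/(_ (x j))]; rewrite !U_at eqxx.
      by rewrite eq_sym (negbTE (xy _ jr)); lia.
have win (u : 'X_{1..n.+1}) : wd u = d -> (forall i, i != y -> u i != 0 -> window i) ->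
    u \in wmonoms d.
  move=> ud h; rewrite mem_wmonoms ud eqxx /=; apply/forallP => i.
  by apply/implyP => /andP[]; exact: h.
move=> u; rewrite ![in X in X -> _]mem_cat -!orbA => /or4P[/hD[ud h _ _ _]||/mapP[j /JP[jr _] ->]|].
- exact: win.
- case/mapP => b; rewrite mem_wmonoms => /andP[/eqP bd /forallP h] ->; apply: win.
    by rewrite wdeg_add bd wdeg_muln wdegU /wtR (negbTE v0y); lia.
  move=> i iy; rewrite mnmDE U_at; case: (eqVneq v0 i) => [<- //|_].
  by rewrite addn0 => bi; have := h i; rewrite iy bi.
- apply: win; first by rewrite wdeg_muln wdegU /wtR (negbTE (xy _ jr)) mul1n.
  move=> i iy; rewrite U_at; case: (eqVneq (x j) i) => [<- _|//].
  by rewrite /window xE; lia.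
rewrite /L4; case: ifP => // /negbT ed; rewrite inE => /eqP ->; apply: win.
  by rewrite wdeg_muln wdegU /wtR eqxx; lia.
by move=> i iy; rewrite U_at (eq_sym y) (negbTE iy).
Qed.

End Counting.

(** * Trading powers of x for powers of y *)

Section Trade.
Local Open Scope nat_scope.
Variable n : nat.
Local Notation y := (@ord_max n).
Local Notation wd := (wdeg (@wtR n)).

Lemma mulU_at (i j : 'I_n.+1) e : (U_(i) *+ e)%MM j = (i == j) * e.
Proof. by rewrite mulmnE mnm1E. Qed.

Lemma wdeg_supp (A : seq 'I_n.+1) (t : 'X_{1..n.+1}) : uniq A -> (forall i, i \notin A -> t i = 0) ->
  wd t = \sum_(i <- A) t i * wtR i.
Proof.
move=> uA h; rewrite [RHS]big_uniq // [RHS]big_mkcond /=.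
by apply: eq_bigr => i _; case: ifPn => // /h ->.
Qed.

Lemma xne s : s < n -> (inord s : 'I_n.+1) != y.
Proof. by move=> sn; rewrite -val_eqE /= inordK; lia. Qed.

(** The exponent of y records t(s+2) and the parity of t(s), so that halving the
    exponent of x_s loses nothing; the exponent of x_(s+1) makes up the degree.
    Starting at n + 1, the exponent of y exceeds that of every monomial used at
    the upper ends. *)
Definition trade s d (t : 'X_{1..n.+1}) : 'X_{1..n.+1} :=
  let h := n.+1 + 2 * t (inord s.+2) + odd (t (inord s)) in
  (U_(inord s) *+ (t (inord s))./2
   + U_(inord s.+1) *+ (d - (t (inord s))./2 - 2 * h) + U_(y) *+ h)%MM.

(** For s + 2 = n the third index is that of y, and the exponent there is 0 for
    the monomials in question. *)
Definition three_term s d (t : 'X_{1..n.+1}) :=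
  [/\ forall i, t i != 0 -> i \in [:: inord s; inord s.+1; inord s.+2],
      t (inord s) + t (inord s.+1) + t (inord s.+2) = d & t (inord s.+2) <= n].

Lemma inordE j : j <= n -> (inord j : 'I_n.+1) = j :> nat.
Proof. by move=> jn; rewrite inordK. Qed.

Lemma inord_neq i j : i <= n -> j <= n -> i != j -> (inord i : 'I_n.+1) != inord j.
Proof. by move=> hi hj ij; rewrite -val_eqE /= !inordE. Qed.

Lemma three_termP s d (t : 'X_{1..n.+1}) : s.+1 < n -> wd t = d -> t y = 0 ->
  (s.+2 < n -> t (inord s.+2) <= n) ->
  (forall i : 'I_n.+1, i != y -> t i != 0 -> s <= i <= s.+2) ->
  three_term s d t.
Proof.
move=> sn td ty h1 h2.
have s0 : s <= n by apply: leq_trans (ltnW sn); exact: leqnSn.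
have h3 i : t i != 0 -> i \in [:: inord s; inord s.+1; inord s.+2].
  move=> ti; have iy : i != y by apply: contraNneq ti => ->; rewrite ty.
  have := h2 i iy ti; rewrite !inE -!val_eqE /= !inordE //; last exact: ltnW.
  clear; lia.
have uA : uniq [:: inord s; inord s.+1; inord s.+2 : 'I_n.+1].
  rewrite /= !inE !negb_or !inord_neq //=; first [exact: ltnW | clear; lia].
have h4 i : i \notin [:: inord s; inord s.+1; inord s.+2] -> t i = 0.
  by move=> ni; apply/eqP; apply: contraNT ni; exact: h3.
have e := wdeg_supp uA h4; rewrite td !big_cons big_nil in e.
have w i : t i * wtR i = t i by rewrite /wtR; case: eqP => [->|]; rewrite ?ty ?muln1.
split=> //; first by rewrite e !w addn0 addnA.
have [|s2] := ltnP s.+2 n; first exact: h1.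
by rewrite (_ : inord s.+2 = y) ?ty //; apply: val_inj; rewrite /= inordE //; apply/eqP; rewrite eqn_leq sn s2.
Qed.

Lemma trade_at s d (t : 'X_{1..n.+1}) : s.+1 < n ->
  trade s d t y = n.+1 + 2 * t (inord s.+2) + odd (t (inord s)) /\
  trade s d t (inord s) = (t (inord s))./2.
Proof.
move=> sn; have s0 : s <= n by apply: leq_trans (ltnW sn); exact: leqnSn.
have x01 : (inord s.+1 : 'I_n.+1) != inord s.
  by apply: inord_neq => //; [exact: ltnW | clear; lia].
have x0y : (inord s : 'I_n.+1) != y by apply: xne; exact: ltnW.
have x1y : (inord s.+1 : 'I_n.+1) != y by apply: xne.
rewrite /trade !mnmDE !mulU_at !eqxx (negbTE x0y) (negbTE x1y) (negbTE x01).
by rewrite [y == _]eq_sym (negbTE x0y) !mul0n !mul1n !addn0.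
Qed.

Lemma tradeP s d (t : 'X_{1..n.+1}) : s.+1 < n -> 12 * n + 8 <= d -> three_term s d t ->
  wd (trade s d t) = d /\ n < trade s d t y.
Proof.
move=> sn dn [_ e1 e2]; have [-> _] := trade_at d t sn; split; last by clear; lia.
have x0y : (inord s : 'I_n.+1) != y by apply: xne; exact: ltnW.
have x1y : (inord s.+1 : 'I_n.+1) != y by apply: xne.
rewrite /trade !wdeg_add !wdeg_muln !wdegU /wtR eqxx (negbTE x0y) (negbTE x1y).
by move: e1 e2 dn; clear; lia.
Qed.

Lemma trade_inj s d (t u : 'X_{1..n.+1}) : s.+1 < n -> three_term s d t -> three_term s d u ->
  trade s d t = trade s d u -> t = u.
Proof.
move=> sn [t0 t1 t2] [u0 u1 u2] e.
have [ty ts] := trade_at d t sn; have [uy us] := trade_at d u sn.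
rewrite -e ty in uy; rewrite -e ts in us.
have [e0 e2] : t (inord s) = u (inord s) /\ t (inord s.+2) = u (inord s.+2).
  by move: uy us; clear; lia.
have e1 : t (inord s.+1) = u (inord s.+1) by move: t1 u1; rewrite e0 e2; clear; lia.
apply/mnmP => i.
have [|ni] := boolP (i \in [:: inord s; inord s.+1; inord s.+2]).
  by rewrite !inE => /or3P[] /eqP ->.
have z (v : 'X_{1..n.+1}) :
    (v i != 0 -> i \in [:: inord s; inord s.+1; inord s.+2]) -> v i = 0.
  by move=> h; apply/eqP; apply: contraNT ni.
by rewrite (z t (t0 i)) (z u (u0 i)).
Qed.

End Trade.

(** * Ranges of nonvanishing Betti numbers *)

Lemma subset_card_between (T : finType) (A B : {set T}) i :
  A \subset B -> (#|A| <= i <= #|B|)%N ->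
  exists P : {set T}, [/\ A \subset P, P \subset B & #|P| = i].
Proof.
move=> AB /andP[Ai]; elim: i Ai => [|i IHi] Ai iB.
  by exists A; split=> //; apply/eqP; rewrite -leqn0.
have [e|ne] := eqVneq #|A| i.+1; first by exists A; split.
have [||P [AP PB cP]] := IHi; [lia | lia |].
have /properP[_ [x xB xP]] : P \proper B by rewrite properEcard PB cP.
exists (x |: P); split.
- by apply: subset_trans AP _; exact: subsetUr.
- by rewrite subUset sub1set xB.
- by rewrite cardsU1 xP cP.
Qed.

Section Range.
Local Open Scope nat_scope.
Variables (k : fieldType) (n d N : nat).
Hypothesis d_large : 20 * n + 20 <= d.
Local Notation y := (@ord_max n).
Local Notation wd := (wdeg (@wtR n)).
Variables (g : 'I_N.+1 -> veronese k n d) (m : 'I_N.+1 -> 'X_{1..n.+1}).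
Hypothesis g_mono : forall i, veronese_val (g i) = 'X_[m i].
Hypothesis g_min : minimally_generates g.
Variable F : gfree_resolution (fun i => wd (m i) %/ d)
           (M := pres_module g) (@veronese_deg k n d).

Let d_gt1 : 1 < d. Proof. by move: d_large; lia. Qed.
Let d_gt0 : 0 < d. Proof. exact: ltnW. Qed.

(** The smallest exponent whose power of y is a generator. *)
Definition ycap := if odd d then d else d./2.
Definition cap (i : 'I_n.+1) := if i == y then ycap else d.

Lemma ycap_gt0 : 0 < ycap.
Proof. by rewrite /ycap; case: ifP; lia. Qed.

Lemma cap_gt0 i : 0 < cap i.
Proof. by rewrite /cap; case: ifP => // _; exact: ycap_gt0. Qed.

Definition powers := [set v | [exists i, m v == (U_(i) *+ cap i)%MM]].
Definition dividing (f : 'X_{1..n.+1}) := [set v | (m v <= f)%MM].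
(** The generators whose product with f is nonzero modulo the powers. *)
Definition survivors (f : 'X_{1..n.+1}) := [set v | [forall i, m v i + f i < cap i]].

Lemma power_gen : exists pow : 'I_n.+1 -> 'I_N.+1, forall i, m (pow i) = (U_(i) *+ cap i)%MM.
Proof.
suff Q (i : 'I_n.+1) : exists v, m v = (U_(i) *+ cap i)%MM.
  by have [p hp] := fin_all_exists Q; exists p.
have [od|ed] := boolP (odd d).
  have [->|iy] := eqVneq i y.
    by rewrite /cap eqxx /ycap od; exact: (gen_ypow d_gt0 g_mono g_min).
  apply: (gen_deg1 d_gt0 g_mono g_min).
  by rewrite wdeg_muln wdegU /cap /wtR (negbTE iy) mul1n.
apply: (gen_deg1 d_gt0 g_mono g_min).
rewrite wdeg_muln wdegU /cap /wtR /ycap (negbTE ed).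
by case: ifP => _; lia.
Qed.

Lemma card_powers : #|powers| = n.+1.
Proof.
have [pow hp] := power_gen.
have pinj : injective pow.
  move=> i j /(congr1 m); rewrite !hp => /mnmP/(_ i); rewrite !mulU_at eqxx.
  by case: (eqVneq j i) => // _; have := cap_gt0 i; lia.
suff -> : powers = [set pow i | i : 'I_n.+1] by rewrite card_imset // card_ord.
apply/setP => v; rewrite inE; apply/existsP/imsetP => [[i /eqP e]|[i _ ->]].
  by exists i => //; apply: (gen_inj d_gt0 g_mono g_min); rewrite hp.
by exists i; rewrite hp.
Qed.

(** There is one power for each of the n + 1 variables, out of N + 1
    generators. *)
Lemma card_npowers : #|~: powers| + n = N.
Proof. by have := cardsC powers; rewrite card_ord card_powers; lia. Qed.

Lemma npowers_deg v : v \notin powers -> wd (m v) = d.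
Proof.
move=> vp; case: (gen_cases d_gt0 g_mono g_min v) => // -[od e].
case/negP: vp; rewrite inE; apply/existsP; exists y.
by rewrite e /cap eqxx /ycap od.
Qed.

Definition admissible (f : 'X_{1..n.+1}) q := [/\ wd f = q * d, forall i, f i < cap i &
  [disjoint dividing f & survivors f]].

Lemma dividing_npowers (f : 'X_{1..n.+1}) : (forall i, f i < cap i) -> dividing f \subset ~: powers.
Proof.
move=> fc; apply/subsetP => v; rewrite !inE => /mnm_lepP h.
apply/existsP => -[i /eqP e]; have := h i; rewrite e mulU_at eqxx mul1n.
by have := fc i; lia.
Qed.

Lemma survivors_npowers f : survivors f \subset ~: powers.
Proof.
apply/subsetP => v; rewrite !inE => /forallP h.
apply/existsP => -[i /eqP e]; have := h i; rewrite e mulU_at eqxx mul1n; lia.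
Qed.

Lemma survivors_deg f v : v \in survivors f -> wd (m v) = d.
Proof. by move=> /(subsetP (survivors_npowers f)); rewrite in_setC => /npowers_deg. Qed.

(** Any i between the two bounds is the size of a set P to which [betti_neq0]
    applies. *)
Lemma betti_range f q i : admissible f q -> #|dividing f| <= i ->
  i + #|survivors f| + n <= N -> betti F i (i + q)%N != 0.
Proof.
move=> [fq fc dis] di iN.
pose Ann := ~: powers :\: survivors f.
have cAnn : #|Ann| + #|survivors f| = #|~: powers|.
  by rewrite cardsD (setIidPr (survivors_npowers f)) subnK // subset_leq_card // survivors_npowers.
have dAnn : dividing f \subset Ann.
  by rewrite subsetD dividing_npowers.
have [|P [dP PA cP]] := @subset_card_between _ _ _ i dAnn.
  rewrite di /= -(leq_add2r #|survivors f|) cAnn -(leq_add2r n) card_npowers. exact: iN.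
have [pow hp] := power_gen.
have Q v : exists t, v \in P -> t \in powers /\ (m t <= f + m v)%MM.
  have [vP|] := boolP (v \in P); last by exists v.
  have := subsetP PA v vP; rewrite !in_setD inE => /andP[].
  rewrite negb_forall => /existsP[j]; rewrite -leqNgt => hj _.
  exists (pow j) => _; split; first by rewrite inE; apply/existsP; exists j; rewrite hp.
  apply/mnm_lepP => x; rewrite hp mulU_at mnmDE.
  by case: (eqVneq j x) => [<-|] //=; rewrite mul1n addnC.
have [tau htau] := fin_all_exists Q.
have H := @betti_neq0 k n d N.+1 d_gt0 g m g_mono P (fun v => v \in powers) tau f q fq _ _ _ F.
have := H; rewrite (eq_bigr (fun=> 1)) => [|v vP]; last first.
  have := subsetP PA v vP; rewrite !in_setD => /andP[_]; rewrite in_setC => /npowers_deg ->.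
  by rewrite divnn d_gt0.
rewrite sum1_card cP; apply.
- move=> v vP; have [t1 t2] := htau v vP; split=> //.
  by have := subsetP PA v vP; rewrite in_setD in_setC => /andP[].
- move=> u v x; rewrite !inE => /existsP[i1 /eqP e1] /existsP[i2 /eqP e2].
  move=> h1 h2; apply: (gen_inj d_gt0 g_mono g_min); move: h1 h2; rewrite e1 e2 !mulU_at.
  by case: (eqVneq i1 x) => // ->; case: (eqVneq i2 x) => // ->.
- by move=> v vf; apply: (subsetP dP); rewrite inE.
Qed.

(** The lower end comes from f1 and the upper end from f2; the inequality says that
    the two intervals overlap or are adjacent. *)
Lemma betti_range2 f1 f2 q (Fq Bq : int) :
  admissible f1 q -> admissible f2 q ->
  #|dividing f2| + #|survivors f1| <= #|~: powers| ->
  (#|dividing f1|%:Z <= Fq)%R -> (Bq <= N%:Z - n%:Z - #|survivors f2|%:Z)%R ->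
  forall i : int, (Fq <= i <= Bq)%R -> betti F i (i + q%:Z)%R != 0.
Proof.
move=> a1 a2 ov hF hB [i|i] hi; last by exfalso; lia.
have cN := card_npowers.
have [h|h] := leqP (i + #|survivors f1| + n) N.
  by apply: (betti_range a1) => //; lia.
by apply: (betti_range a2) => //; lia.
Qed.

Lemma overlap_disjoint (f1 f2 : 'X_{1..n.+1}) : (forall i, f2 i < cap i) ->
  [disjoint dividing f2 & survivors f1] ->
  #|dividing f2| + #|survivors f1| <= #|~: powers|.
Proof.
move=> f2c dis; rewrite -cardsUI; move: dis; rewrite -setI_eq0 => /eqP ->.
rewrite cards0 addn0; apply: subset_leq_card.
by rewrite subUset dividing_npowers // survivors_npowers.
Qed.

(** * The monomials at the ends of the ranges *)

(** Pushing the exponents of the first variables to their maximal value makes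
    most generators kill this monomial, while its divisors involve few
    variables. *)
Definition corner (s b c : nat) : 'X_{1..n.+1} :=
  [multinom if i == y then c else if i < s then d.-1 else if i == s :> nat then b else 0 | i < n.+1].

Lemma wdeg_corner s b c : s < n -> wd (corner s b c) = s * d.-1 + b + c * 2.
Proof.
move=> sn; rewrite wdegE mnmE eqxx; congr (_ + _).
pose G i := if i < s then d.-1 else if i == s then b else 0.
rewrite (eq_bigr (fun i : 'I_n => G i)) => [|i _]; last first.
  by rewrite mnmE ifF // -val_eqE /= ltn_eqF.
rewrite -(big_mkord predT G) (@big_cat_nat _ _ _ s) //=; last by lia.
rewrite (eq_big_nat _ _ (F2 := fun=> d.-1)) => [|i /andP[_ h]]; last by rewrite /G h.
rewrite sum_nat_const_nat subn0; congr (_ + _).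
rewrite big_ltn // /G ltnn eqxx big_nat big1 ?addn0 // => i h.
by case: ifP; [lia | move=> _; case: ifP; lia].
Qed.

Lemma corner_cap s b c : b < d -> c < ycap -> forall i, corner s b c i < cap i.
Proof.
move=> bd cy i; rewrite mnmE /cap; case: ifP => // _.
by case: ifP => _; [lia | case: ifP; lia].
Qed.

Lemma dividingP s b c v : v \in dividing (corner s b c) ->
  [/\ forall i : 'I_n.+1, i != y -> i < s -> m v i < d,
      forall i : 'I_n.+1, i != y -> i = s :> nat -> m v i <= b,
      forall i : 'I_n.+1, i != y -> s < i -> m v i = 0 & m v y <= c].
Proof.
rewrite inE => /mnm_lepP h; split=> [i iy si|i iy si|i iy si|].
- by have := h i; rewrite mnmE (negbTE iy) si; lia.
- by have := h i; rewrite mnmE (negbTE iy) si ltnn eqxx.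
- by have := h i; rewrite mnmE (negbTE iy) ltnNge (ltnW si) gtn_eqF //=; lia.
- by have := h y; rewrite mnmE eqxx.
Qed.

Lemma survivorsP s b c v : v \in survivors (corner s b c) ->
  [/\ forall i : 'I_n.+1, i != y -> i < s -> m v i = 0,
      forall i : 'I_n.+1, i != y -> i = s :> nat -> m v i + b < d,
      forall i : 'I_n.+1, i != y -> m v i < d & m v y + c < ycap].
Proof.
rewrite inE => /forallP h; split=> [i iy si|i iy si|i iy|].
- by have := h i; rewrite mnmE /cap (negbTE iy) si; lia.
- by have := h i; rewrite mnmE /cap (negbTE iy) si ltnn eqxx.
- by have := h i; rewrite /cap (negbTE iy); lia.
- by have := h y; rewrite mnmE /cap eqxx.
Qed.

(** A generator dividing the corner and surviving it involves only x_s and y, and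
    the two conditions cap its exponents. *)
Lemma disjoint_corner s b c : s < n -> b < d -> c < ycap ->
  minn b (d.-1 - b) + minn c (ycap.-1 - c) * 2 < d ->
  [disjoint dividing (corner s b c) & survivors (corner s b c)].
Proof.
move=> sn bd cy lt; apply/pred0P => v /=; apply/negbTE/negP => /andP[vd vs].
have wv : wd (m v) = d by exact: survivors_deg vs.
have [h1 h2 h3 h4] := dividingP vd; have [k1 k2 k3 k4] := survivorsP vs.
have xs := xne sn; have xE : (inord s : 'I_n.+1) = s :> nat by rewrite inordK; lia.
have := @wdeg_supp n [:: inord s; y] (m v); rewrite wv !big_cons big_nil /= inE xs /=.
rewrite /wtR (negbTE xs) eqxx => /(_ isT) e.
have := h2 _ xs xE; have := k2 _ xs xE; move: e.
set p := m v (inord s); move=> e e1 e2.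
have : d = p * 1 + (m v y * 2 + 0).
  apply: e => i; rewrite !inE negb_or => /andP[i1 i2].
  have [lt1|lt1|e3] := ltngtP i s; [exact: k1 | exact: h3 |].
  by case/eqP: i1; apply: val_inj; rewrite /= e3 xE.
by lia.
Qed.

Lemma admissible_corner s b c q : s < n -> b < d -> c < ycap ->
  s * d.-1 + b + c * 2 = q * d ->
  minn b (d.-1 - b) + minn c (ycap.-1 - c) * 2 < d -> admissible (corner s b c) q.
Proof.
move=> sn bd cy e lt; split; first by rewrite wdeg_corner.
  exact: corner_cap.
exact: disjoint_corner.
Qed.

(** The window consists of the first s + 1 variables x, with cap b at the last. *)
Lemma card_dividing s b c : s < n -> b < d -> c < ycap ->
  #|dividing (corner s b c)| + nmonoms s (d - b.+1) + s + ~~ odd d <= nmonoms s d.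
Proof.
move=> sn bd cy; rewrite cardE -(size_map m).
have xs := xne sn; have xE : (inord s : 'I_n.+1) = s :> nat by rewrite inordK; lia.
apply: (@count_caps n 0 s _ d _ (inord s)) => //.
- by rewrite /window xE; lia.
- by rewrite map_inj_uniq ?enum_uniq //; exact: (gen_inj d_gt0 g_mono g_min).
move=> u /mapP[v]; rewrite mem_enum => vd ->.
have [h1 h2 h3 h4] := dividingP vd; split.
- apply: npowers_deg; have := subsetP (dividing_npowers (corner_cap s bd cy)) _ vd.
  by rewrite inE.
- by move=> i iy; apply: contraR => w0; apply/eqP; apply: h3 => //; move: w0; rewrite /window; lia.
- exact: h2.
- move=> i iy; have [lt1|lt1|e3] := ltngtP i s; first exact: h1.
    by rewrite (h3 _ iy lt1); lia.
  by have := h2 _ iy e3; lia.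
- by move: cy; rewrite /ycap => + ed; rewrite (negbTE ed); lia.
Qed.

(** The window consists of the variables x from x_s on, with cap d - 1 - b at the
    first. *)
Lemma card_survivors s b c : s < n -> b < d ->
  #|survivors (corner s b c)| + nmonoms (n - s - 1) b + (n - s - 1) + ~~ odd d
    <= nmonoms (n - s - 1) d.
Proof.
move=> sn bd; rewrite cardE -(size_map m) (_ : b = d - (d.-1 - b).+1); last by lia.
have xs := xne sn; have xE : (inord s : 'I_n.+1) = s :> nat by rewrite inordK; lia.
apply: (@count_caps n s (n - s - 1) _ d _ (inord s)) => //; try lia.
- by rewrite /window xE; lia.
- by rewrite map_inj_uniq ?enum_uniq //; exact: (gen_inj d_gt0 g_mono g_min).
move=> u /mapP[v]; rewrite mem_enum => vs ->.
have [k1 k2 k3 k4] := survivorsP vs; split.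
- exact: survivors_deg vs.
- move=> i iy i0; rewrite /window; apply/andP; split; last first.
    by move: iy; rewrite -val_eqE /=; have := ltn_ord i; lia.
  by rewrite leqNgt; apply: contraNN i0 => /(k1 _ iy) ->.
- by have := k2 _ xs xE; lia.
- exact: k3.
- by move: k4; rewrite /ycap => + ed; rewrite (negbTE ed); lia.
Qed.

Lemma lem_wdeg_eq (t u : 'X_{1..n.+1}) : (t <= u)%MM -> wd t = wd u -> t = u.
Proof.
move=> tu; rewrite -{1}(submK tu) wdeg_add => e.
have e0 : (u - t)%MM == 0%MM by apply: contraT => /wdeg_gt0; lia.
by rewrite -(submK tu) (eqP e0) add0m.
Qed.

Lemma card_dividing_deg1 f : admissible f 1 -> #|dividing f| <= 1.
Proof.
case=> fd fc _; apply/card_le1_eqP => u v uf vf.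
suff E w : w \in dividing f -> m w = f.
  by apply: (gen_inj d_gt0 g_mono g_min); rewrite !E.
move=> wf; have := subsetP (dividing_npowers fc) _ wf; rewrite in_setC => /npowers_deg wd1.
by apply: lem_wdeg_eq; [move: wf; rewrite inE | rewrite wd1 fd mul1n].
Qed.

(** The sets D of divisors of f2 and E of survivors of the corner need not be
    disjoint.  Their intersection is injected by [trade] into the generators with
    exponent of y above n.  These are in neither set: the exponent is too large
    to divide f2, and a single y turns the factor y^(d-1) of the corner into the
    power y^d. *)
Lemma overlap_odd s b (f2 : 'X_{1..n.+1}) : odd d -> s.+1 < n ->
  (forall i, f2 i < cap i) -> f2 y <= n ->
  {in dividing f2 :&: survivors (corner s b d.-1), forall v,
     (s.+2 < n -> m v (inord s.+2) <= n) /\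
     forall i : 'I_n.+1, i != y -> m v i != 0 -> s <= i <= s.+2} ->
  #|dividing f2| + #|survivors (corner s b d.-1)| <= #|~: powers|.
Proof.
move=> od sn f2c f2y hX.
have dn : 12 * n + 8 <= d by move: d_large; clear; lia.
set f1 := corner s b d.-1 in hX *; set X := _ :&: _ in hX.
pose Y := [set v | (n < m v y) && (wd (m v) == d)].
have XT v : v \in X -> three_term s d (m v).
  move=> vX; have [h1 h2] := hX v vX; move: vX; rewrite in_setI => /andP[_ vs].
  apply: three_termP => //.
    exact: survivors_deg vs.
  by have [_ _ _] := survivorsP vs; rewrite /ycap od; clear; lia.
have XY : #|X| <= #|Y|.
  rewrite !cardE -(size_map (fun v => trade s d (m v))) -[size (enum Y)](size_map m).
  apply: uniq_leq_size => [|u /mapP[v]].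
    rewrite map_inj_in_uniq ?enum_uniq // => u v; rewrite !mem_enum => uX vX e.
    apply: (gen_inj d_gt0 g_mono g_min).
    exact: (trade_inj sn (XT _ uX) (XT _ vX) e).
  rewrite mem_enum => vX ->; have [td ty] := tradeP sn dn (XT v vX).
  have [w ew] := gen_deg1 d_gt0 g_mono g_min td.
  by apply/mapP; exists w => //; rewrite mem_enum inE ew td eqxx ty.
rewrite -cardsUI -/X; apply: leq_trans (leq_add (leqnn _) XY) _.
have dis : (dividing f2 :|: survivors f1) :&: Y = set0.
  apply/setP => v; rewrite in_setI in_setU in_set0 [v \in Y]inE.
  apply/negbTE/negP => /andP[h /andP[vy _]]; case/orP: h.
    by rewrite inE => /mnm_lepP/(_ y); rewrite leqNgt (leq_ltn_trans f2y vy).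
  by move=> /survivorsP[_ _ _]; move: vy; rewrite /ycap od; clear; lia.
rewrite -cardsUI dis cards0 addn0; apply: subset_leq_card.
rewrite !subUset dividing_npowers // survivors_npowers /=.
apply/subsetP => v; rewrite !inE => /andP[vy /eqP vd]; apply/existsP => -[i /eqP e].
move: vy vd; rewrite e mulU_at wdeg_muln wdegU /cap /wtR /ycap od.
by case: (eqVneq i y) => _; move: d_gt1; clear; lia.
Qed.

Lemma ycap_large : 8 * n + 8 <= ycap.
Proof. by rewrite /ycap; case: ifP; lia. Qed.

(** With the largest possible power of y, few variables x are left and few
    generators divide this monomial; it serves for the lower bound F_q. *)
Lemma front_admissible s q : s < n -> s.+1 + odd d = q ->
  admissible (corner s s.+2 ycap.-1) q.
Proof.
move=> sn <-; have := ycap_large => yl; apply: admissible_corner => //; try lia.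
by rewrite /ycap; case: ifP => od; rewrite ?od /=; nia.
Qed.

(** A survivor would divide the complementary monomial x_(n-1)^(d-n-2), whose
    degree is less than d. *)
Lemma front_survivors0 : 0 < n -> survivors (corner n.-1 n.+1 ycap.-1) = set0.
Proof.
move=> n0; apply/setP => v; rewrite in_set0; apply/negbTE/negP => vs.
have wv : wd (m v) = d by exact: survivors_deg vs.
have [k1 k2 k3 k4] := survivorsP vs.
have sn : n.-1 < n by lia.
have xs := xne sn; have xE : (inord n.-1 : 'I_n.+1) = n.-1 :> nat by rewrite inordK; lia.
have := @wdeg_supp n [:: inord n.-1; y] (m v); rewrite wv !big_cons big_nil /= inE xs /=.
rewrite /wtR (negbTE xs) eqxx => /(_ isT) e.
have e1 := k2 _ xs xE; move: e e1; set p := m v (inord n.-1) => e e1.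
have : d = p * 1 + (m v y * 2 + 0).
  apply: e => i; rewrite !inE negb_or => /andP[i1 i2]; apply: k1 => //.
  by move: i1 i2; rewrite -!val_eqE /= xE; have := ltn_ord i; lia.
by lia.
Qed.

(** With as many x as possible at their maximal exponents, few generators survive
    this monomial; it serves for the upper bound B_q when q < n. *)
Lemma back_admissible q : 0 < q < n -> admissible (corner q q 0) q.
Proof.
move=> /andP[q0 qn]; have := ycap_large => yl; apply: admissible_corner => //; try lia.
Qed.

(** The analogue of [back_admissible] for q = n and d odd: the powers of the x
    alone have degree at most n (d - 1), and y supplies the rest. *)
Lemma last_admissible : odd d -> 1 < n ->
  admissible (corner n.-1 (d.-1 - odd n) (uphalf n)) n.
Proof.
move=> od n1; have := ycap_large => yl; apply: admissible_corner; try lia.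
Qed.

(** Survivors divide the complementary monomial, a power of y times x_(n-1) for n
    odd and a power of y for n even; its
    only possible divisor of odd degree d is x_(n-1) y^((d-1)/2). *)
Lemma last_survivors : odd d -> 1 < n ->
  #|survivors (corner n.-1 (d.-1 - odd n) (uphalf n))| <= odd n.
Proof.
move=> od n1; set f := corner _ _ _.
have E v : v \in survivors f -> odd n /\ m v = (U_(inord n.-1) + U_(y) *+ d./2)%MM.
  move=> vs.
  have wv : wd (m v) = d by exact: survivors_deg vs.
  have [k1 k2 k3 k4] := survivorsP vs.
  have sn : n.-1 < n by lia.
  have xs := xne sn; have xE : (inord n.-1 : 'I_n.+1) = n.-1 :> nat by rewrite inordK; lia.
  have := @wdeg_supp n [:: inord n.-1; y] (m v); rewrite wv !big_cons big_nil /= inE xs /=.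
  rewrite /wtR (negbTE xs) eqxx => /(_ isT) e.
  have e1 := k2 _ xs xE; move: e e1; set p := m v (inord n.-1) => e e1.
  have z i : i \notin [:: inord n.-1; y] -> m v i = 0.
    rewrite !inE negb_or => /andP[i1 i2]; apply: k1 => //.
    by move: i1 i2; rewrite -!val_eqE /= xE; have := ltn_ord i; lia.
  have e2 : d = p * 1 + (m v y * 2 + 0) by exact: e.
  have on : odd n by lia.
  split=> //; apply/mnmP => i; rewrite mnmDE mulU_at mnm1E.
  case: (eqVneq i (inord n.-1)) => [->|i1].
    by rewrite -/p [y == _]eq_sym (negbTE xs); lia.
  case: (eqVneq i y) => [->|i2].
    by lia.
  by rewrite z ?inE ?negb_or ?i1 ?i2.
have [on|en] := boolP (odd n).
  apply/card_le1_eqP => u v /E[_ eu] /E[_ ev].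
  by apply: (gen_inj d_gt0 g_mono g_min); rewrite eu ev.
rewrite leqn0 cards_eq0; apply/eqP/setP => v; rewrite in_set0; apply/negbTE/negP.
by move=> /E[]; rewrite (negbTE en).
Qed.

Lemma overlap_even q : ~~ odd d -> 2 <= q < n ->
  #|dividing (corner q q 0)| + #|survivors (corner q.-1 q.+1 ycap.-1)| <= #|~: powers|.
Proof.
move=> ed /andP[q2 qn]; have := ycap_large => yl.
have q0 : q.-1.+1 = q by clear -q2; lia.
apply: overlap_disjoint; first by apply: corner_cap; move: d_large yl qn; clear; lia.
apply/pred0P => v /=; apply/negbTE/negP => /andP[vd vs].
have wv : wd (m v) = d by exact: survivors_deg vs.
have [h1 h2 h3 h4] := dividingP vd; have [k1 k2 k3 k4] := survivorsP vs.
have x0y : (inord q.-1 : 'I_n.+1) != y by apply: xne; rewrite -q0 in qn; exact: ltnW.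
have xy : (inord q : 'I_n.+1) != y by exact: xne.
have xE : (inord q : 'I_n.+1) = q :> nat by apply: inordE; exact: ltnW.
have x0E : (inord q.-1 : 'I_n.+1) = q.-1 :> nat.
  by apply: inordE; apply: leq_trans (leq_pred _) (ltnW qn).
have x01 : (inord q.-1 : 'I_n.+1) != inord q.
  by rewrite -val_eqE /= xE x0E -{2}q0 ltn_eqF.
have uA : uniq [:: inord q.-1; inord q; y] by rewrite /= !inE !negb_or x0y xy x01.
have := wdeg_supp (t := m v) uA; rewrite wv !big_cons big_nil => e.
have {}e := e _; have ty : m v y = 0 by move: k4 yl; clear; lia.
have := k2 _ x0y x0E; have := h2 _ xy xE.
suff : d = m v (inord q.-1) + m v (inord q).
  move: (m v (inord q.-1)) (m v (inord q)) q0 => a b; clear; lia.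
rewrite {1}e /wtR ?(negbTE x0y) ?(negbTE xy) ?ty ?muln1 ?addn0 // => i.
rewrite !inE !negb_or => /and3P[i0 i1 iy].
have [lt1|lt1|e1] := ltngtP i q; last by case/eqP: i1; apply: val_inj; rewrite /= xE.
  apply: k1 => //; move: lt1; rewrite -{1}q0 ltnS leq_eqVlt => /orP[/eqP e1|//].
  by case/eqP: i0; apply: val_inj; rewrite /= x0E.
exact: h3.
Qed.

Lemma overlap_odd_back q : odd d -> 2 <= q < n ->
  #|dividing (corner q q 0)| + #|survivors (corner (q - 2) q ycap.-1)| <= #|~: powers|.
Proof.
move=> od /andP[q2 qn]; have := ycap_large => yl.
have q0 : (q - 2).+2 = q by clear -q2; lia.
have -> : ycap.-1 = d.-1 by rewrite /ycap od.
apply: overlap_odd => //.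
- by rewrite -q0 in qn; exact: ltnW.
- by apply: corner_cap; move: d_large yl qn; clear; lia.
- by rewrite mnmE eqxx.
move=> v; rewrite in_setI q0 => /andP[/dividingP[_ h2 h3 _] /survivorsP[k1 _ _ _]]; split.
  move=> _; apply: leq_trans (ltnW qn); apply: h2; first exact: xne.
  by apply: inordE; exact: ltnW.
move=> i iy i0; apply/andP; split; rewrite leqNgt; apply: contraNN i0.
  by move=> h; rewrite k1.
by move=> h; rewrite h3.
Qed.

Lemma overlap_odd_last : odd d -> 1 < n ->
  #|dividing (corner n.-1 (d.-1 - odd n) (uphalf n))|
    + #|survivors (corner (n - 2) n ycap.-1)| <= #|~: powers|.
Proof.
move=> od n1; have := ycap_large => yl.
have -> : ycap.-1 = d.-1 by rewrite /ycap od.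
apply: overlap_odd => //.
- by clear -n1; lia.
- by apply: corner_cap; move: d_large yl; clear; lia.
- by rewrite mnmE eqxx; clear -n1; lia.
move=> v; rewrite in_setI => /andP[_ /survivorsP[k1 _ _ _]]; split.
  by move=> h; exfalso; clear -h n1; lia.
move=> i iy i0; apply/andP; split; last by have := ltn_ord i; clear -n1; lia.
by rewrite leqNgt; apply: contraNN i0 => h; rewrite k1.
Qed.

End Range.

(** * The nonvanishing ranges *)

Theorem theorem2 (n : nat) (n_ge2 : (2 <= n)%N) :
  exists d0 : nat, forall (d : nat), (d0 < d)%N ->
  forall (k : fieldType) (N : nat)
    (* k-algebra generators of R^(d), namely the images of z_0, ..., z_N *)
    (g : 'I_N.+1 -> veronese k n d) (m : 'I_N.+1 -> 'X_{1..n.+1})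
    (g_mono : forall i, veronese_val (g i) = 'X_[m i])
    (g_min : minimally_generates g)
    (* a graded free resolution of R^(d) over S = k[z_0, ..., z_N] with
       deg z_i = (deg_R m_i) / d *)
    (F : gfree_resolution (fun i => wdeg (@wtR n) (m i) %/ d)%N
           (M := pres_module g) (@veronese_deg k n d)),
  let nonvanishing (q : nat) (Fq Bq : int) :=
    forall i : int, Fq <= i <= Bq -> betti F i (i + q%:Z) != 0%N in
  [/\ (* (1) *)
      ~~ odd d -> nonvanishing 1%N 1
        (N%:Z - (\sum_(0 <= b < (d./2).+1) 'C(d - 2 * b + n - 2, n - 2))%N%:Z
         + n%:Z - 2),
      (* (2) *)
      odd d -> nonvanishing 1%N 1
        (N%:Z
         - (\sum_(0 <= b < ((d - 1)./2).+1) 'C(d - 2 * b + n - 2, n - 2))%N%:Z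
         + n%:Z - 3),
      (* (3), (4) *)
      forall q : nat, (2 <= q <= n - 1)%N ->
        (~~ odd d -> nonvanishing q
          ((\sum_(0 <= b < (d./2).+1) 'C(d - 2 * b + q - 1, q - 1))%N%:Z
           - (\sum_(0 <= b < ((d - q - 2)./2).+1)
                'C(d - 2 * b - 3, q - 1))%N%:Z - q%:Z)
          (N%:Z
           - (\sum_(0 <= b < (d./2).+1)
                'C(d - 2 * b + n - q - 1, n - q - 1))%N%:Z
           + (\sum_(0 <= b < (q./2).+1) 'C(n - 1 - 2 * b, n - q - 1))%N%:Z
           - q%:Z)) /\
        (odd d -> nonvanishing q
          ((\sum_(0 <= b < ((d - 1)./2).+1) 'C(d - 2 * b + q - 2, q - 2))%N%:Z
           - (\sum_(0 <= b < ((d - q - 1)./2).+1)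
                'C(d - 2 * b - 3, q - 2))%N%:Z - q%:Z + 2)
          (N%:Z
           - (\sum_(0 <= b < ((d - 1)./2).+1)
                'C(d - 2 * b + n - q - 1, n - q - 1))%N%:Z
           + (\sum_(0 <= b < (q./2).+1) 'C(n - 1 - 2 * b, n - q - 1))%N%:Z
           - q%:Z - 1)),
      (* (5) and (6) *)
      (~~ odd d -> nonvanishing n
        ((\sum_(0 <= b < (d./2).+1) 'C(d - 2 * b + n - 1, n - 1))%N%:Z
         - (\sum_(0 <= b < ((d - n - 2)./2).+1)
              'C(d - 2 * b - 3, n - 1))%N%:Z - n%:Z)
        (N%:Z - n%:Z)) /\
      (odd d -> nonvanishing n
        ((\sum_(0 <= b < ((d - 1)./2).+1) 'C(d - 2 * b + n - 2, n - 2))%N%:Z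
         - (\sum_(0 <= b < ((d - n - 1)./2).+1)
              'C(d - 2 * b - 3, n - 2))%N%:Z - n%:Z + 2)
        (N%:Z - n%:Z - (n %% 2)%N%:Z)) &
      (* (7) *)
      odd d -> nonvanishing n.+1
        ((\sum_(0 <= b < ((d - 1)./2).+1) 'C(d - 2 * b + n - 1, n - 1))%N%:Z
         - (\sum_(0 <= b < ((d - n - 2)./2).+1)
              'C(d - 2 * b - 3, n - 1))%N%:Z - n%:Z + 1)
        (N%:Z - n%:Z)].
Proof.
(* All inequalities below are linear in n; the bound leaves slack for each. *)
exists (20 * n + 20)%N => d hd k N g m g_mono g_min F nonvanishing.
have d_large : (20 * n + 20 <= d)%N by exact: ltnW.
have yl := ycap_large d_large.
have range := betti_range2 d_large g_mono g_min F.
have range1 (f : 'X_{1..n.+1}) q (Fq Bq : int) : admissible d m f q ->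
    ((#|dividing m f|)%:Z <= Fq)%R -> (Bq <= N%:Z - n%:Z - (#|survivors d m f|)%:Z)%R ->
    nonvanishing q Fq Bq.
  move=> a; have [_ fc dis] := a; apply: (range f f) => //.
  exact: (overlap_disjoint d_large).
have surv q : (0 < q < n)%N ->
  (#|survivors d m (corner n d q q 0)| + nmonoms (n - q - 1) q + (n - q - 1) + ~~ odd d
    <= nmonoms (n - q - 1) d)%N.
  move=> /andP[q0 qn]; apply: (card_survivors d_large g_mono g_min) => //.
  by clear -qn d_large; lia.
have divs s : (s < n)%N ->
  (#|dividing m (corner n d s s.+2 (ycap d).-1)| + nmonoms s (d - s.+3) + s + ~~ odd d
   <= nmonoms s d)%N.
  move=> sn; apply: (card_dividing d_large g_mono g_min) => //.
    by clear -sn d_large; lia.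
  by clear -yl; lia.
have back q := @back_admissible k n d N d_large g m g_mono g_min q.
have front s q := @front_admissible k n d N d_large g m g_mono g_min s q.
have n0 : (n.-1 < n)%N by clear -n_ge2; lia.
have end0 : #|survivors d m (corner n d n.-1 n.+1 (ycap d).-1)| = 0%N.
  by rewrite (front_survivors0 d_large g_mono g_min) ?cards0 //; exact: ltnW.
have sumd r e (G : nat -> nat) (t : nat) : e = d./2 -> t = r ->
   (forall b, (b <= d./2)%N -> G b = d - 2 * b + r)%N ->
    (\sum_(0 <= b < e.+1) 'C(G b, t) = nmonoms r d)%N.
  by move=> -> -> hG; apply: eq_big_nat => b hb; rewrite hG.
have sumf s c t : (s < n)%N -> (c = d - s.+3)%N -> t = s ->
    (\sum_(0 <= b < c./2.+1) 'C(d - 2 * b - 3, t) = nmonoms s (d - s.+3))%N.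
  by move=> sn -> ->; rewrite nmonoms_front //; move: sn d_large; clear; lia.
have sumb q : (q < n)%N ->
    (\sum_(0 <= b < q./2.+1) 'C(n - 1 - 2 * b, n - q - 1))%N = nmonoms (n - q - 1) q.
  by move=> qn; rewrite (nmonoms_back qn).
(* For q = 1 the correction term of B_q is C(n - 1, n - 2). *)
have nb1 : nmonoms (n - 1 - 1) 1 = (n - 1)%N.
  by rewrite /nmonoms big_nat1 (_ : (1 - 2 * 0 + (n - 1 - 1) = (n - 1 - 1).+1)%N) ?binSn //;
    clear -n_ge2; lia.
have q1 : (0 < 1 < n)%N by [].
split.
- move=> ed; apply: (range1 _ _ _ _ (back 1%N q1)).
    by have := card_dividing_deg1 d_large g_mono g_min (back 1%N q1); clear; lia.
  rewrite (sumd (n - 1 - 1)%N) //; try by clear -n_ge2; lia.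
  by have := surv 1%N q1; rewrite nb1 ed; clear -n_ge2; lia.
- move=> od; apply: (range1 _ _ _ _ (back 1%N q1)).
    by have := card_dividing_deg1 d_large g_mono g_min (back 1%N q1); clear; lia.
  rewrite (sumd (n - 1 - 1)%N) //; try by clear -n_ge2 od; lia.
  by have := surv 1%N q1; rewrite nb1 od; clear -n_ge2; lia.
- move=> q /andP[q2 qn1]; have qn : (q < n)%N by clear -qn1 n_ge2; lia.
  have q0n : (0 < q < n)%N by rewrite qn andbT; exact: ltnW.
  have hs := surv q q0n; split=> [ed|od].
    have sn : (q.-1 < n)%N by clear -qn; lia.
    have hd1 := divs q.-1 sn.
    have e1 : q.-1.+1 = q by clear -q2; lia.
    have fa : admissible d m (corner n d q.-1 q.+1 (ycap d).-1) q.
      by rewrite -{2}e1; apply: front => //; rewrite e1 (negbTE ed) addn0.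
    rewrite e1 in hd1.
    apply: (range _ _ _ _ _ fa (back q q0n)).
    + by apply: (overlap_even d_large g_mono g_min) => //; rewrite q2.
    + rewrite (sumd q.-1) ?(sumf q.-1) //; try by clear -q2; lia.
      by move: hd1; rewrite ed e1; clear -q2; lia.
    + rewrite (sumd (n - q - 1)%N) ?sumb //; try by clear -qn; lia.
      by move: hs; rewrite ed; clear -qn; lia.
  have sn : (q - 2 < n)%N by clear -qn; lia.
  have hd1 := divs (q - 2)%N sn.
  have e1 : (q - 2).+2 = q by clear -q2; lia.
  have fa : admissible d m (corner n d (q - 2) q (ycap d).-1) q.
    by rewrite -{2}e1; apply: front => //; rewrite od addn1.
  rewrite e1 in hd1.
  apply: (range _ _ _ _ _ fa (back q q0n)).
  + by apply: (overlap_odd_back d_large g_mono g_min) => //; rewrite q2.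
  + rewrite (sumd (q - 2)%N) ?(sumf (q - 2)%N) //; try by clear -q2 od; lia.
    by move: hd1; rewrite od e1; clear -q2; lia.
  + rewrite (sumd (n - q - 1)%N) ?sumb //; try by clear -qn od; lia.
    by move: hs; rewrite od; clear -qn; lia.
- split=> [ed|od].
    have hd1 := divs n.-1 n0.
    have e1 : n.-1.+1 = n by clear -n_ge2; lia.
    have fa : admissible d m (corner n d n.-1 n.+1 (ycap d).-1) n.
      by have := front n.-1 n n0; rewrite e1 (negbTE ed) addn0; apply.
    rewrite e1 in hd1.
    apply: (range1 _ _ _ _ fa).
      rewrite (sumd n.-1) ?(sumf n.-1) //; try by clear -n_ge2; lia.
      by move: hd1; rewrite ed e1; clear -n_ge2; lia.
    by rewrite end0; clear; lia.
  have sn : (n - 2 < n)%N by clear -n_ge2; lia.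
  have hd1 := divs (n - 2)%N sn.
  have e1 : (n - 2).+2 = n by clear -n_ge2; lia.
  have fa : admissible d m (corner n d (n - 2) n (ycap d).-1) n.
    by have := front (n - 2)%N n sn; rewrite od addn1 e1; apply.
  rewrite e1 in hd1.
  apply: (range _ _ _ _ _ fa (last_admissible d_large g_mono g_min od n_ge2)).
  + exact: (overlap_odd_last d_large g_mono g_min).
  + rewrite (sumd (n - 2)%N) ?(sumf (n - 2)%N) //; try by clear -n_ge2 od; lia.
    by move: hd1; rewrite od e1; clear -n_ge2; lia.
  + by have := last_survivors d_large g_mono g_min od n_ge2; clear; lia.
- move=> od; have hd1 := divs n.-1 n0.
  have e1 : n.-1.+1 = n by clear -n_ge2; lia.
  have fa : admissible d m (corner n d n.-1 n.+1 (ycap d).-1) n.+1.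
    by have := front n.-1 n.+1 n0; rewrite e1 od addn1; apply.
  rewrite e1 in hd1.
  apply: (range1 _ _ _ _ fa).
    rewrite (sumd n.-1) ?(sumf n.-1) //; try by clear -n_ge2 od; lia.
    by move: hd1; rewrite od e1; clear -n_ge2; lia.
  by rewrite end0; clear; lia.
Qed.
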